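(* Let $K\subset\mathbb{R}^n$ be a convex body. The following are equivalent: \begin{enumerate} \item[(i)] $K$ is in isominwidth position. \item[(ii)] $K-K$ is in isominwidth position. \item[(iii)] $(K-K)/\mathrm{w}(K)$ is in John position. \item[(iv)] $\bigcap_{u\in\mathrm{W}_K}H^-(\mathbb{B}_2^n,u)$ is in John position. \item[(v)] There exist an $m\in\{n,\dots,\binom{n+1}{2}\}$, scalars $\lambda_1,\dots,\lambda_m\ge 0$, and minwidth directions $u_1,\dots,u_m\in\mathrm{W}_K$ such that \[ \mathrm{I}_n=\sum_{i=1}^m\lambda_i u_iu_i^{\intercal}. \] \end{enumerate}
   Context: A convex body in $\mathbb{R}^n$ is a compact convex set with nonempty interior. $K-K=\{x-y:x,y\in K\}$. For $u\neq 0$, $h(K,u)=\max\{x^{\intercal}u:x\in K\}$ is the support function and $H^-(K,u)=\{x\in\mathbb{R}^n:x^{\intercal}u\le h(K,u)\}$ the supporting halfspace containing $K$; $\mathbb{B}_2^n$ is the Euclidean unit ball. The minimum width is $\mathrm{w}(K)=\min_{u\in\mathbb{S}^{n-1}}(h(K,u)+h(K,-u))$, and $\mathrm{W}_K=\{u\in\mathbb{S}^{n-1}:h(K,u)+h(K,-u)=\mathrm{w}(K)\}$ is the set of minwidth directions. The isominwidth quotient is $\operatorname{iwq}(K)=\mathrm{vol}(K)/\mathrm{w}(K)^n$, and $K$ is in isominwidth position if $\operatorname{iwq}(K)=\min_{A\in\mathrm{GL}_n(\mathbb{R})}\operatorname{iwq}(AK)$. A closed convex set is in John position if it contains $\mathbb{B}_2^n$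 and $\mathbb{B}_2^n$ has maximum volume among all ellipsoids, with arbitrary center, contained in it. $\mathrm{I}_n$ is the $n\times n$ identity matrix. *)

(* Defs.v *)
From mathcomp Require Import all_boot all_order all_algebra.
From mathcomp Require Import all_classical all_reals all_analysis.

Set Implicit Arguments.
Unset Strict Implicit.
Unset Printing Implicit Defensive.

Import Order.TTheory GRing.Theory Num.Theory.
Import numFieldNormedType.Exports.

Local Open Scope classical_set_scope.
Local Open Scope ring_scope.

Section Volume.
Variables (R : realType) (n : nat).

Definition box (a b : 'cV[R]_n) : set 'cV[R]_n :=
  [set x | forall i, a i 0 < x i 0 <= b i 0].

(* Lebesgue outer measure on R^n: the infimum of the total volumes of the
   countable coverings by boxes. It agrees with Lebesgue measure on
   Lebesgue-measurable sets, in particular on compact sets. *)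
Definition volume (E : set 'cV[R]_n) : \bar R :=
  ereal_inf [set (\sum_(0 <= k <oo) (\prod_i (ab.2 k i 0 - ab.1 k i 0))%:E)%E
    | ab in [set ab : (nat -> 'cV[R]_n) * (nat -> 'cV[R]_n) |
        (forall k i, ab.1 k i 0 <= ab.2 k i 0) /\
        E `<=` \bigcup_k box (ab.1 k) (ab.2 k)]].

End Volume.

Section ConvexBodies.
Variables (R : realType) (n : nat).
Implicit Types (K C E : set 'cV[R]_n) (u x y c : 'cV[R]_n) (A : 'M[R]_n).

Definition dot x y : R := (x^T *m y) 0 0.

Definition unit_ball : set 'cV[R]_n := [set x | Num.sqrt (dot x x) <= 1].

Definition unit_sphere : set 'cV[R]_n := [set x | Num.sqrt (dot x x) = 1].

Definition convex_body K : Prop :=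
  [/\ compact K, convex_set (K : set (convex_lmodType 'cV[R]_n))
    & interior K !=set0].

Definition difference_body K : set 'cV[R]_n :=
  [set x - y | x in K & y in K].

Definition linear_image A K : set 'cV[R]_n := [set A *m x | x in K].

Definition dilation (t : R) K : set 'cV[R]_n := [set t *: x | x in K].

(* For nonempty compact [K] the supremum is a maximum; likewise, for [0 < n],
   the infimum in [width] is then a minimum. *)
Definition support K u : R := sup [set dot x u | x in K].

Definition supporting_halfspace K u : set 'cV[R]_n :=
  [set x | dot x u <= support K u].

Definition width K : R :=
  inf [set support K u + support K (- u) | u in unit_sphere].

Definition minwidth_directions K : set 'cV[R]_n :=
  [set u | unit_sphere u /\ support K u + support K (- u) = width K].

Definition iwq K : \bar R := (volume K * ((width K ^+ n)^-1)%:E)%E.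

Definition isominwidth_position K : Prop :=
  forall A, A \in unitmx -> (iwq K <= iwq (linear_image A K))%E.

Definition ellipsoid E : Prop :=
  exists A c, A \in unitmx /\ E = [set A *m x + c | x in unit_ball].

(* [C] is meant to be closed and convex, but not necessarily bounded. *)
Definition john_position C : Prop :=
  unit_ball `<=` C /\
  forall E, ellipsoid E -> E `<=` C -> (volume E <= volume unit_ball)%E.

End ConvexBodies.

(* Main.v *)
(* Put D = K - K and N(u) = h(K,u) + h(K,-u), the support function of D.  As
   vol(AK) = |det A| vol(K) and the breadth of AK in direction u is N(A^T u),
   both (i) and (ii) say that w(AK)^n <= |det A| w(K)^n for all invertible A,
   and this is what John position of D / w(K) says about A^-1, once a centre is
   removed by the symmetry of D.

   If I is not a nonnegative combination of the u u^T with u in a compact set W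
   of unit vectors, then the point nearest to I in the compact convex set of
   all combinations of trace n yields H with u^T H u <= -c < 0 on W and
   tr H > 0; for small e > 0 the ellipsoid (I + e H) B has larger volume than B
   and still lies in D / w(K) (for W = W_K), respectively in the intersection
   of the halfspaces. Hence (iii) and (iv) imply (v). Conversely, I = sum_i l_i
   u_i u_i^T gives sum_i l_i |M u_i|^2 = tr(M M^T) >= n |det M|^(2/n) for every
   M, which yields (i) with M = A^-T and (iv) with M = A^T. *)
Require Import Defs.
From mathcomp Require Import all_boot all_order all_algebra.
From mathcomp Require Import all_classical all_reals all_analysis.
From mathcomp Require Import measurable_realfun ring lra.

Set Implicit Arguments.
Unset Strict Implicit.
Unset Printing Implicit Defensive.

Import Order.TTheory GRing.Theory Num.Theory.
Import numFieldNormedType.Exports.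

Local Open Scope classical_set_scope.
Local Open Scope ring_scope.

(** [volume] is an infimum over coverings, so its determinant formula has to be derived. Only the
    inequality [<=] is proved directly, factor by factor for elementary matrices; applied to the
    inverse matrix it gives equality. A single covering bounds a volume only from above, so
    positivity of the volume of a cube needs a separate argument by integration. Positivity and
    finiteness are what allow the volumes of K and of the ball to be cancelled.

    The number C(n+1, 2), the dimension of the space of symmetric matrices, serves twice: it bounds
    m in (v), and it turns combinations of arbitrary length into combinations of one fixed length,
    whose slice of trace n is compact.

    The intersection in (iv) contains D / w(K), so (iii) does not give (iv) by inclusion; the cycle
    passes through (v). In the step from (iii) to (v) the matrix H controls only directions near
    W_K; where it is not negative enough, a compactness gap between N(u) and w(K) takes over. *)

Section ElementaryMatrices.
Variable F : fieldType.

(** For [i != j] this is a shear, for [i = j] a scaling of one coordinate by [1 + c]. Coordinate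
    swaps are left out of the family, being products of its members. *)
Definition elementary_mx n (i j : 'I_n) (c : F) : 'M[F]_n :=
  1%:M + c *: delta_mx i j.

Lemma elementary_mxE n p (i j : 'I_n) c (M : 'M[F]_(n, p)) k l :
  (elementary_mx i j c *m M) k l = M k l + c *+ (k == i) * M j l.
Proof.
rewrite mulmxDl mul1mx mxE -scalemxAl mxE; congr (_ + _).
rewrite mxE (bigD1 j) //= big1 => [|h hj]; last first.
  by rewrite mxE (negbTE hj) andbF mul0r.
by rewrite mxE eqxx andbT addr0 mulrA mulr_natr.
Qed.

Lemma det_elementary_mx n (i j : 'I_n) (c : F) :
  \det (elementary_mx i j c) = 1 + c *+ (i == j).
Proof.
wlog ji : i j / (j <= i)%N.
  move=> wh; have [|ij] := leqP j i; first exact: wh.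
  rewrite -det_tr linearD /= trmx1 linearZ /= trmx_delta eq_sym.
  exact: (wh j i (ltnW ij)).
rewrite det_trig; last first.
  apply/is_trig_mxP => k l kl; rewrite !mxE (_ : k == l = false); last first.
    by apply/eqP => kE; rewrite kE ltnn in kl.
  case: eqP => [ki|_]; case: eqP => [lj|_]; rewrite ?mulr0 ?addr0 //.
  by move: kl; rewrite ki lj ltnNge ji.
rewrite (bigD1 i) //= big1 => [|k ki]; rewrite !mxE eqxx.
  by rewrite /= mulr_natr mulr1.
by rewrite (negbTE ki) mulr0 addr0.
Qed.

(* After making the top left entry nonzero by a row operation, A factors as
   lower unitriangular * block diagonal * upper unitriangular. *)
Lemma unitmx_elementary_ind n (P : 'M[F]_n -> Prop) :
  P 1%:M ->
  (forall i j c, \det (elementary_mx i j c) != 0 -> P (elementary_mx i j c)) ->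
  (forall A B, P A -> P B -> P (A *m B)) ->
  forall A, A \in unitmx -> P A.
Proof.
elim: n => [|n IH] in P * => P1 Pe PM A Au.
  by rewrite [A]flatmx0 -[X in P X](flatmx0 1%:M).
wlog A00 : A Au / A 0 0 != 0.
  move=> wh; have [A00|] := eqVneq (A 0 0) 0; last exact: wh.
  have [i Ai] : exists i, A i 0 != 0.
    apply/existsP; rewrite -negb_forall; apply/negP => /forallP A0.
    move: Au; rewrite unitmxE unitfE (expand_det_col A 0) big1 ?eqxx // => i _.
    by rewrite (eqP (A0 i)) mul0r.
  have i0 : 0 != i by apply/eqP => iE; rewrite -iE A00 eqxx in Ai.
  have detE c : \det (elementary_mx 0 i c) = 1.
    by rewrite det_elementary_mx (negbTE i0) addr0.
  have eu c : elementary_mx 0 i c \in unitmx by rewrite unitmxE detE unitr1.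
  have -> : A = elementary_mx 0 i (-1) *m (elementary_mx 0 i 1 *m A).
    rewrite mulmxA [X in X *m A](_ : _ = 1%:M) ?mul1mx //.
    rewrite /elementary_mx mulmxDl mul1mx -scalemxAl mulmxDr mulmx1 -scalemxAr.
    rewrite mul_delta_mx_cond eq_sym (negbTE i0) mulr0n !scaler0 addr0.
    by rewrite scaleN1r scale1r addrK.
  apply: PM; first by apply: Pe; rewrite detE oner_eq0.
  apply: wh; first by rewrite unitmx_mul eu.
  by rewrite elementary_mxE A00 add0r mulr1n mul1r.
have l0 : lshift n 0 = 0 :> 'I_(1 + n) by exact: val_inj.
have delta_ul : delta_mx (lshift n 0) (lshift n 0) = block_mx 1 0 0 0 :> 'M[F]_(1 + n).
  rewrite delta_mx_ushift delta_mx_lshift /block_mx row_mx0; congr (col_mx (row_mx _ _) _).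
  by apply/matrixP => i j; rewrite !ord1 !mxE.
have delta_dl i : delta_mx (rshift 1 i) (lshift n 0) =
    block_mx 0 0 (delta_mx i 0) 0 :> 'M[F]_(1 + n).
  by rewrite delta_mx_dshift delta_mx_lshift /block_mx row_mx0.
have delta_ur i : delta_mx (lshift n 0) (rshift 1 i) =
    block_mx 0 (delta_mx 0 i) 0 0 :> 'M[F]_(1 + n).
  by rewrite delta_mx_ushift delta_mx_rshift /block_mx row_mx0.
have delta_dr i j :
    delta_mx (rshift 1 i) (rshift 1 j) = block_mx 0 0 0 (delta_mx i j) :> 'M[F]_(1 + n).
  by rewrite delta_mx_dshift delta_mx_rshift /block_mx row_mx0.
have one_block : 1%:M = block_mx 1 0 0 1%:M :> 'M[F]_(1 + n).
  exact: scalar_mx_block.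
have {}Pe (i j : 'I_(1 + n)) c : \det (elementary_mx i j c) != 0 ->
  (P : 'M[F]_(1 + n) -> Prop) (elementary_mx i j c) := Pe i j c.
have {}PM (B C : 'M[F]_(1 + n)) : (P : 'M[F]_(1 + n) -> Prop) B ->
  (P : 'M[F]_(1 + n) -> Prop) C -> (P : 'M[F]_(1 + n) -> Prop) (B *m C) := PM B C.
have Pdl (v : 'cV_n) : P (block_mx 1 0 v 1%:M).
  (* Multiplying two such block matrices adds their columns, so [v] can be built up from multiples
     of delta columns, each of which gives an elementary matrix. *)
  have PD (x y : 'cV_n) : P (block_mx 1 0 x 1%:M) -> P (block_mx 1 0 y 1%:M) ->
      P (block_mx 1 0 (x + y) 1%:M).
    move=> Px Py; have := PM _ _ Px Py.
    by rewrite mulmx_block !mul1mx !mul0mx !mulmx0 !mulmx1 !addr0 add0r.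
  rewrite (matrix_sum_delta v).
  elim/big_rec : _ => [|i x _ Px]; first by rewrite -one_block.
  apply: PD => //; rewrite big_ord1.
  have := Pe (rshift 1 i) (lshift n 0) (v i 0); rewrite det_elementary_mx addr0 oner_eq0.
  rewrite /elementary_mx delta_dl one_block scale_block_mx add_block_mx !scaler0.
  by rewrite !addr0 add0r; exact.
have Pur (w : 'rV_n) : P (block_mx 1 w 0 1%:M).
  have PD (x y : 'rV_n) : P (block_mx 1 x 0 1%:M) -> P (block_mx 1 y 0 1%:M) ->
      P (block_mx 1 (x + y) 0 1%:M).
    move=> Px Py; have := PM _ _ Py Px.
    by rewrite mulmx_block !mul1mx !mul0mx !mulmx0 !mulmx1 !addr0 add0r.
  rewrite (matrix_sum_delta w) big_ord1.
  elim/big_rec : _ => [|i x _ Px]; first by rewrite -one_block.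
  apply: PD => //.
  have := Pe (lshift n 0) (rshift 1 i) (w 0 i); rewrite det_elementary_mx addr0 oner_eq0.
  rewrite /elementary_mx delta_ur one_block scale_block_mx add_block_mx !scaler0.
  by rewrite !addr0 add0r; exact.
have Pul (a : F) : a != 0 -> P (block_mx (a%:M : 'M[F]_1) 0 0 (1%:M : 'M[F]_n)).
  move=> a0; have := Pe (lshift n 0) (lshift n 0) (a - 1).
  rewrite det_elementary_mx eqxx mulr1n subrKC => /(_ a0).
  rewrite /elementary_mx delta_ul one_block scale_block_mx.
  rewrite add_block_mx !scaler0 !addr0 scalemx1.
  by rewrite -[1 in X in P X]/(1%:M) -(raddfD (@scalar_mx F 1)) subrKC.
have Pdr (S : 'M[F]_n) : S \in unitmx -> P (block_mx (1 : 'M[F]_1) 0 0 S).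
  apply: (IH (fun S => P (block_mx (1 : 'M[F]_1) 0 0 S))) => [|i j c|B C PB PC].
  - by rewrite -one_block.
  - have := Pe (rshift 1 i) (rshift 1 j) c; rewrite !det_elementary_mx eq_shift.
    rewrite /elementary_mx delta_dr one_block scale_block_mx add_block_mx.
    by rewrite !scaler0 !addr0.
  - have := PM _ _ PB PC.
    by rewrite mulmx_block !mul1mx !mul0mx !mulmx0 !addr0 add0r.
pose A' : 'M[F]_(1 + n) := A; pose a := A 0 0; pose w := ursubmx A'; pose v := dlsubmx A'.
(* The Schur complement of the pivot [a]; it is invertible because [A] is, so the induction
   hypothesis applies to it. *)
pose S := drsubmx A' - a^-1 *: (v *m w).
have ulE : ulsubmx A' = a%:M.
  apply/matrixP => i j; rewrite !ord1 !mxE eqxx mulr1n /a.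
  by congr (A _ _); exact: val_inj.
have AE : A' = block_mx 1 0 (a^-1 *: v) 1%:M *m
    (block_mx a%:M 0 0 1%:M *m block_mx 1 0 0 S) *m
    block_mx 1 (a^-1 *: w) 0 1%:M.
  rewrite -[LHS]submxK ulE -/w -/v !mulmx_block.
  rewrite !mul1mx !mul0mx !mulmx0 !mulmx1 !addr0 !add0r.
  rewrite -scalemxAl mul_mx_scalar mul_scalar_mx scalerA divff // scale1r.
  rewrite scalerA mulVf // scale1r -scalemxAr.
  by rewrite mulmx0 add0r /S addrC subrK.
rewrite -/A' AE; apply: (PM _ _ (PM _ _ (Pdl _) (PM _ _ (Pul _ A00) (Pdr _ _))) (Pur _)).
move: Au; rewrite -/A' AE !unitmx_mul => /andP[/andP[_ /andP[_]]] + _.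
have -> // : (S \in unitmx) = ((block_mx (1 : 'M[F]_1) 0 0 S : 'M[F]_(1 + n)) \in unitmx).
by rewrite !unitmxE det_ublock det1 mul1r.
Qed.

End ElementaryMatrices.

(** * Determinant inequalities: Hadamard, trace bound, first order perturbation *)

Section DeterminantBounds.
Variable R : realFieldType.

Definition quad n (S : 'M[R]_n) (x : 'cV[R]_n) : R := (x^T *m S *m x) 0 0.

Lemma quad_block n (a t : R) (v y : 'cV[R]_n) (S : 'M[R]_n) :
  quad (block_mx a%:M v^T v S : 'M[R]_(1 + n)) (col_mx t%:M y) =
  a * t ^+ 2 + 2 * t * (v^T *m y) 0 0 + quad S y.
Proof.
rewrite /quad tr_col_mx mul_row_block mul_row_col !mulmxDl tr_scalar_mx.
rewrite -scalar_mxM !mul_scalar_mx !mul_mx_scalar -!scalemxAl.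
have vy : (y^T *m v) 0 0 = (v^T *m y) 0 0.
  by rewrite -[y^T *m v]trmxK trmx_mul trmxK mxE.
have addE (B C : 'M[R]_1) : (B + C) 0 0 = B 0 0 + C 0 0 by rewrite mxE.
have scaleE c (B : 'M[R]_1) : (c *: B) 0 0 = c * B 0 0 by rewrite mxE.
by rewrite !addE !scaleE vy mxE eqxx mulr1n; ring.
Qed.

Lemma quad_delta n (S : 'M[R]_n) i : quad S (delta_mx i 0) = S i i.
Proof.
by rewrite /quad trmx_delta -rowE -colE !mxE.
Qed.

(* Induction on the size, through the Schur complement of the first entry. *)
Lemma hadamard_psd n (S : 'M[R]_n) :
  S^T = S -> (forall x, 0 <= quad S x) -> \det S <= \prod_i S i i.
Proof.
elim: n => [|n IH] in S *; first by rewrite det_mx00 big_ord0.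
pose S' : 'M[R]_(1 + n) := S; pose a := S 0 0; pose v := dlsubmx S'; pose T := drsubmx S'.
move=> Ssym Spsd.
have ulE : ulsubmx S' = a%:M.
  apply/matrixP => i j; rewrite !ord1 !mxE eqxx mulr1n /a.
  by congr (S _ _); exact: val_inj.
have urE : ursubmx S' = v^T by rewrite /v trmx_dlsub (Ssym : S'^T = S').
have Tsym : T^T = T by rewrite /T trmx_drsub (Ssym : S'^T = S').
have SE : S' = block_mx a%:M v^T v T by rewrite -[LHS]submxK ulE urE.
have qS t y : 0 <= a * t ^+ 2 + 2 * t * (v^T *m y) 0 0 + quad T y.
  by rewrite -quad_block -SE; exact: Spsd.
have a0 : 0 <= a by rewrite /a -quad_delta; exact: Spsd.
have prodE : \prod_i S i i = a * \prod_i T i i.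
  rewrite big_ord_recl; congr (_ * _); apply: eq_bigr => i _.
  by rewrite !mxE; congr (S _ _); exact: val_inj.
have T0 i : 0 <= T i i.
  by have := qS 0 (delta_mx i 0); rewrite quad_delta expr0n /= !mulr0 mul0r !add0r.
have [aE|an0] := eqVneq a 0.
  rewrite prodE aE mul0r.
  suff v0 : v = 0.
    rewrite -[\det S]/(\det S') SE v0 aE trmx0 det_ublock.
    by rewrite det_mx11 mxE mul0r.
  have vv : (v^T *m v) 0 0 = \sum_i v i 0 ^+ 2.
    by rewrite mxE; apply: eq_bigr => i _; rewrite mxE.
  have : (v^T *m v) 0 0 <= 0.
    rewrite leNgt; apply/negP => v0.
    (* With [a = 0] the form is affine in the first coordinate, with nonzero slope; this choice of
       it gives the value -1. *)
    have := qS (- (quad T v + 1) / (2 * (v^T *m v) 0 0)) v.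
    rewrite aE mul0r add0r.
    have -> : forall q p : R, p != 0 -> 2 * (- (q + 1) / (2 * p)) * p + q = -1.
      by move=> q p p0; field.
      by rewrite oppr_ge0 ler10.
    by rewrite gt_eqF.
  rewrite vv => vle; apply/matrixP => i j; rewrite ord1 [RHS]mxE.
  have /eqP := le_anti (introT andP (conj vle (sumr_ge0 _ (fun i _ => sqr_ge0 (v i 0))))).
  rewrite psumr_eq0 => [/allP/(_ i (mem_index_enum _))|k _]; last exact: sqr_ge0.
  by rewrite /= sqrf_eq0 => /eqP.
have ap : 0 < a by rewrite lt_neqAle eq_sym an0.
pose C := T - a^-1 *: (v *m v^T).
(* [quad C y] is the minimum over [t] of the form of [S] at [(t, y)], attained at
   [t = - a^-1 v^T y]; hence [C] inherits nonnegativity. *)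
have qC y : quad C y = a * (- (a^-1 * (v^T *m y) 0 0)) ^+ 2 +
    2 * (- (a^-1 * (v^T *m y) 0 0)) * (v^T *m y) 0 0 + quad T y.
  have -> : quad C y = quad T y - a^-1 * (v^T *m y) 0 0 ^+ 2.
    rewrite /quad /C mulmxBr mulmxBl -scalemxAr -scalemxAl.
    have -> : y^T *m (v *m v^T) *m y = (v^T *m y)^T *m (v^T *m y).
      by rewrite trmx_mul trmxK !mulmxA.
    rewrite [v^T *m y]mx11_scalar tr_scalar_mx -scalar_mxM.
    by rewrite !mxE !eqxx !mulr1n expr2.
  by field.
have Csym : C^T = C.
  by rewrite /C linearB linearZ /= trmx_mul trmxK Tsym.
have C0 y : 0 <= quad C y by rewrite qC; exact: qS.
have -> : \det S = a * \det C.
  have S'E : S' = block_mx 1 0 (a^-1 *: v) 1%:M *m block_mx a%:M v^T 0 C.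
    rewrite mulmx_block !mul1mx !mul0mx !addr0 SE.
    by rewrite mul_mx_scalar scalerA divff // scale1r -scalemxAl addrC subrK.
  rewrite -[\det S]/(\det S') S'E det_mulmx det_lblock det_ublock.
  by rewrite !det1 !mul1r det_mx11 mxE eqxx mulr1n.
rewrite prodE ler_wpM2l //; apply: le_trans (IH _ Csym C0) _.
(* Each diagonal entry of [C] is that of [T] less a square divided by [a]. *)
apply: ler_prod => i _; rewrite -quad_delta C0 /= qC quad_delta.
set p := (v^T *m _) 0 0.
have : 0 <= a^-1 * p ^+ 2 by rewrite mulr_ge0 ?invr_ge0 ?sqr_ge0.
have -> : a * (- (a^-1 * p)) ^+ 2 + 2 * - (a^-1 * p) * p = - (a^-1 * p ^+ 2) by field.
lra.
Qed.

(** Hadamard's inequality for the Gram matrix [A *m A^T], then the inequality of arithmetic and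
    geometric means for its diagonal. *)
Lemma det_sqr_le n (A : 'M[R]_n) : (0 < n)%N ->
  \det A ^+ 2 <= (\tr (A *m A^T) / n%:R) ^+ n.
Proof.
move=> n0.
have trE : \tr (A *m A^T) = \sum_i (A *m A^T) i i by [].
have diag_ge0 i : 0 <= (A *m A^T) i i.
  by rewrite mxE; apply: sumr_ge0 => j _; rewrite mxE -expr2 sqr_ge0.
rewrite trE expr2 -[X in _ * X]det_tr -det_mulmx.
apply: le_trans (hadamard_psd _ _) _.
- by rewrite trmx_mul trmxK.
- move=> x; rewrite /quad mulmxA -mulmxA -[X in _ *m X]trmxK.
  rewrite trmx_mul trmxK mxE; apply: sumr_ge0 => j _.
  by rewrite [X in _ * X]mxE -expr2 sqr_ge0.
have := leif_AGM (A := 'I_n) (E := fun i => (A *m A^T) i i) (fun i _ => diag_ge0 i).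
by rewrite card_ord => -[].
Qed.

(* det (1 + e H) = e^n q(1/e) for the characteristic polynomial q of - H. *)
Lemma det_perturbation_gt1 n (H : 'M[R]_n) : 0 < \tr H ->
  exists2 e0 : R, 0 < e0 & forall e, 0 < e <= e0 -> 1 < \det (1%:M + e *: H).
Proof.
case: n => [|n] in H *; first by rewrite /mxtrace big_ord0 ltxx.
move=> trH; pose q := char_poly (- H).
pose C := \sum_(i < n) `|q`_i|.
have C0 : 0 <= C by apply: sumr_ge0.
(* For [e <= 1] the terms of order at least 2 in [e] sum to at least [- e^2 C], and
   [e (C + 1) <= tr H] keeps this loss strictly below the linear gain [e tr H]. *)
exists (Num.min 1 (\tr H / (C + 1))) => [|e].
  by rewrite lt_min ltr01 divr_gt0 // ltr_wpDl.
rewrite le_min => /andP[e0 /andP[e1]]; rewrite ler_pdivlMr ?ltr_wpDl // => eC.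
have en0 : e != 0 by rewrite gt_eqF.
have detE : \det (1%:M + e *: H) = e ^+ n.+1 * q.[e^-1].
  rewrite /q /char_poly -horner_evalE -det_map_mx -detZ; congr (\det _).
  apply/matrixP => i j; rewrite !mxE /= horner_evalE !hornerE.
  by rewrite hornerMn hornerX; case: eqP => _; rewrite ?mulr1n ?mulr0n; field.
have pw i : (i <= n.+1)%N -> e ^+ n.+1 * e^-1 ^+ i = e ^+ (n.+1 - i).
  by move=> ni; rewrite exprVn expfB_cond // (negbTE en0).
rewrite detE horner_coef size_char_poly big_ord_recr big_ord_recr /=.
have -> : q`_n.+1 = 1.
  by have := char_poly_monic (- H); rewrite monicE lead_coefE size_char_poly => /eqP.
have -> : q`_n = \tr H.
  by rewrite (@char_poly_trace _ n.+1) // linearN opprK.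
rewrite mul1r !mulrDr mulr_sumr pw // subnn (mulrCA _ (\tr H)) pw // subSnn expr1.
have : - (e ^+ 2 * C) <= \sum_(i < n) e ^+ n.+1 * (q`_i * e^-1 ^+ i).
  rewrite /C mulr_sumr -sumrN; apply: ler_sum => i _.
  rewrite mulrCA pw; last by rewrite ltnW // ltnS ltnW.
  have [p0 p2] : 0 <= e ^+ (n.+1 - i) /\ e ^+ (n.+1 - i) <= e ^+ 2.
    split; first by rewrite exprn_ge0 // ltW.
    by apply: (ler_wiXn2l (ltW e0) e1); rewrite ltn_subRL addn1 ltnS.
  have := ler_norm (- q`_i); rewrite normrN; have := normr_ge0 q`_i; nra.
nra.
Qed.

End DeterminantBounds.

(** * Caratheodory's theorem for cones of rank one matrices *)

Section Caratheodory.
Variables (R : realFieldType) (n : nat).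
Implicit Types (W : 'cV[R]_n -> Prop) (X Y : 'M[R]_n).

(** Negating a linear dependence if necessary makes some coefficient positive; such a coefficient is
    what lets a weight be driven to zero in [rank_one_sum_pred]. *)
Lemma conic_dependence m d (v : 'I_m -> 'rV[R]_d) : (d < m)%N ->
  exists2 c : 'I_m -> R, \sum_i c i *: v i = 0 & exists i, 0 < c i.
Proof.
move=> dm; pose M := \matrix_i v i.
have : kermx M != 0.
  rewrite kermx_eq0 /row_free neq_ltn (leq_ltn_trans _ dm) //.
  exact: rank_leq_col.
case/rowV0Pn => c /sub_kermxP cM c0.
have sumE (b : 'rV_m) : b *m M = \sum_i b 0 i *: v i.
  rewrite mulmx_sum_row; apply: eq_bigr => i _; by rewrite rowK.
have [i ci] : exists i, c 0 i != 0.
  apply/existsP; rewrite -negb_forall; apply: contra c0 => /forallP c0.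
  by apply/eqP/rowP => i; rewrite mxE; apply/eqP.
have [ip|iN|i0] := ltgtP (c 0 i) 0; last by rewrite i0 eqxx in ci.
  exists (fun i => (- c) 0 i); first by rewrite -sumE mulNmx cM oppr0.
  by exists i; rewrite mxE oppr_gt0.
by exists (c 0); [rewrite -sumE|exists i].
Qed.

(** Index set for the independent entries of a symmetric matrix. *)
Definition upper_pair := {p : 'I_n * 'I_n | (p.1 <= p.2)%N}.

Lemma card_upper_pair : #|{: upper_pair}| = 'C(n.+1, 2).
Proof.
rewrite card_sig -bin2_sum big_nat_recl // add0n big_mkord -sum1_card.
rewrite (eq_bigl (fun p : 'I_n * 'I_n => xpredT p.1 && (p.1 <= p.2)%N)) //.
rewrite -(pair_big_dep xpredT (fun i j : 'I_n => (i <= j)%N) (fun _ _ => 1%N)) /=.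
rewrite (exchange_big_dep xpredT) //=; apply: eq_bigr => j _.
rewrite (big_ord_narrow (ltn_ord j)).
by rewrite sum1_card card_ord.
Qed.

Definition upper_part X : 'rV[R]_#|{: upper_pair}| :=
  \row_k X (val (enum_val k)).1 (val (enum_val k)).2.

Lemma upper_part_inj X : X^T = X -> upper_part X = 0 -> X = 0.
Proof.
move=> Xsym X0.
have up (i j : 'I_n) : (i <= j)%N -> X i j = 0.
  move=> ij; pose p : upper_pair := exist _ (i, j) ij.
  by have /rowP/(_ (enum_rank p)) := X0; rewrite !mxE enum_rankK.
apply/matrixP => i j; rewrite mxE.
by have [/up//|/ltnW/up <-] := leqP i j; rewrite -[in LHS]Xsym mxE.
Qed.

(** The length is exact, but zero weights and repeated vectors are allowed, so a shorter sum can be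
    padded with any point of [W]. *)
Definition rank_one_sum W m X := exists (l : 'I_m -> R) (u : 'I_m -> 'cV[R]_n),
  [/\ forall i, 0 <= l i, forall i, W (u i)
    & X = \sum_(i < m) l i *: (u i *m (u i)^T)].

Lemma rank_one_sumS W m X : rank_one_sum W m.+1 X <->
  exists Y l u, [/\ rank_one_sum W m Y, 0 <= l, W u & X = l *: (u *m u^T) + Y].
Proof.
split=> [[l [u [l0 Wu ->]]]|[Y [l [u [[l' [u' [l'0 Wu' ->]]] l0 Wu ->]]]]].
  exists (\sum_(i < m) l (lift ord0 i) *: (u (lift ord0 i) *m (u (lift ord0 i))^T)).
  exists (l ord0), (u ord0); split=> //; last by rewrite big_ord_recl.
  by exists (fun i => l (lift ord0 i)), (fun i => u (lift ord0 i)).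
exists (fun i => if unlift ord0 i is Some j then l' j else l).
exists (fun i => if unlift ord0 i is Some j then u' j else u).
split=> [i|i|]; [by case: unlift|by case: unlift|].
rewrite big_ord_recl unlift_none; congr (_ + _).
by apply: eq_bigr => i _; rewrite liftK.
Qed.

(** More terms than the dimension of the symmetric matrices force a dependence. The multiple [t] of
    it that is subtracted from the weights is the least ratio [l i / c i] over positive [c i]: all
    weights stay nonnegative and the minimising one vanishes. *)
Lemma rank_one_sum_pred W m X :
  ('C(n.+1, 2) < m.+1)%N -> rank_one_sum W m.+1 X -> rank_one_sum W m X.
Proof.
rewrite -card_upper_pair => cm [l [u [l0 Wu XE]]].
have [c c_dep [i1 ci1]] := conic_dependence (fun i => upper_part (u i *m (u i)^T)) cm.
have {}c_dep : \sum_i c i *: (u i *m (u i)^T) = 0.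
  apply: upper_part_inj.
    rewrite linear_sum; apply: eq_bigr => i _.
    by rewrite linearZ /= trmx_mul trmxK.
  rewrite -c_dep; apply/rowP => k; rewrite mxE !summxE; apply: eq_bigr => i _.
  by rewrite !mxE.
case: (arg_minP (P := fun i => 0 < c i) (fun i => l i / c i) ci1) => i0 ci0 min_i0.
pose t := l i0 / c i0.
pose l' i := l i - t * c i.
have l'0 i : 0 <= l' i.
  have [cp|cn] := ltP 0 (c i).
    by rewrite subr_ge0 -ler_pdivlMr // min_i0.
  rewrite subr_ge0; apply: le_trans (l0 i).
  by apply: mulr_ge0_le0 => //; exact: divr_ge0 (l0 i0) (ltW ci0).
have l'i0 : l' i0 = 0 by rewrite /l' /t divfK ?subrr // gt_eqF.
exists (fun j => l' (lift i0 j)), (fun j => u (lift i0 j)); split=> //.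
transitivity (\sum_(i < m.+1) l' i *: (u i *m (u i)^T)); last first.
  by rewrite (bigD1_ord i0) //= l'i0 scale0r add0r.
under eq_bigr do rewrite /l' scalerBl -scalerA.
by rewrite sumrB -scaler_sumr c_dep scaler0 subr0.
Qed.

Lemma rank_one_sum_caratheodory W m X : (exists u, W u) ->
  rank_one_sum W m X -> rank_one_sum W 'C(n.+1, 2) X.
Proof.
move=> [u0 Wu0]; elim: m => [|m IH] Xm; last first.
  have [Cm|mC] := ltnP 'C(n.+1, 2) m.+1; first exact/IH/rank_one_sum_pred.
  rewrite -(subnK mC); elim: (_ - _)%N => // k IHk; rewrite addSn.
  by apply/rank_one_sumS; exists X, 0, u0; rewrite scale0r add0r.
rewrite -[X in rank_one_sum _ X]addn0; elim: 'C(_, _) => // k IHk; rewrite addSn.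
by apply/rank_one_sumS; exists X, 0, u0; rewrite scale0r add0r.
Qed.

End Caratheodory.

(** * The outer measure: linear images, positivity, finiteness *)

Section Volume.
Variables (R : realType) (n : nat).
Implicit Types (E F : set 'cV[R]_n) (a b : 'cV[R]_n).
Local Open Scope ereal_scope.

Lemma volume_le_cover (a b : nat -> 'cV[R]_n) E :
  (forall k i, a k i 0 <= b k i 0)%R ->
  E `<=` \bigcup_k box (a k) (b k) ->
  volume E <= \sum_(0 <= k <oo) (\prod_i (b k i 0 - a k i 0))%:E.
Proof.
move=> ab Eab; apply: ereal_inf_lbound.
by exists (a, b).
Qed.

Lemma volume_ge0 E : 0 <= volume E.
Proof.
apply: le_ereal_inf_tmp => _ [[a b] /= [ab _] <-].
apply: nneseries_ge0 => k _ _; rewrite lee_fin prodr_ge0 // => i _.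
by rewrite subr_ge0.
Qed.

Lemma le_volume E F : E `<=` F -> volume E <= volume F.
Proof.
move=> EF; apply: ereal_inf_le_tmp => _ [[a b] /= [ab Fab] <-].
by exists (a, b) => //; split=> //; apply: subset_trans Fab.
Qed.

Lemma volume_adherent E (e : R) : (0 < e)%R -> volume E != +oo ->
  exists a b : nat -> 'cV[R]_n, [/\ forall k i, (a k i 0 <= b k i 0)%R,
  E `<=` \bigcup_k box (a k) (b k) &
  \sum_(0 <= k <oo) (\prod_i (b k i 0 - a k i 0))%:E <= volume E + e%:E].
Proof.
move=> e0 Eoo.
have Efin : volume E \is a fin_num by rewrite ge0_fin_numE ?volume_ge0 ?ltey.
have [_ [[a b] /= [ab Eab] <-] le] := lb_ereal_inf_adherent e0 Efin.
by exists a, b; split => //; exact: ltW.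
Qed.

(** Nearly optimal coverings of [E k], with excess [e / 2 ^ k.+1], are merged into one sequence
    along a bijection of [nat] with [nat * nat]. *)
Lemma volume_sigma_subadditive (E : nat -> set 'cV[R]_n) :
  volume (\bigcup_k E k) <= \sum_(0 <= k <oo) volume (E k).
Proof.
have [[i ioo]|Eoo] := pselect (exists i, volume (E i) = +oo).
  rewrite (eseries_pinfty _ _ ioo) ?leey// => k _.
  by rewrite -ltNye (lt_le_trans _ (volume_ge0 _)).
suff add2e (e : {posnum R}) :
    volume (\bigcup_k E k) <= \sum_(0 <= k <oo) volume (E k) + e%:num%:E.
  by apply/lee_addgt0Pr => _/posnumP[].
apply: le_trans (epsilon_trick _ _ _) => //; last first.
  by move=> k; exact: volume_ge0.
have e2 k : (0 < e%:num / (2 ^ k.+1)%:R :> R)%R by [].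
have := fun k =>
  @volume_adherent (E k) _ (e2 k) (introN eqP (fun h => Eoo (ex_intro _ k h))).
move=> /choice[a /choice[b Hab]].
pose len (p : nat * nat) : \bar R :=
  (\prod_i (b p.1 p.2 i 0 - a p.1 p.2 i 0)%R)%:E.
have len0 p : 0 <= len p.
  rewrite lee_fin prodr_ge0 // => i _; rewrite subr_ge0.
  by case: (Hab p.1).
have /card_esym/ppcard_eqP[f] := card_nat2.
apply: (@le_trans _ _ (\sum_(0 <= k <oo) len (f k))).
  apply: (@volume_le_cover (fun k => a (f k).1 (f k).2) (fun k => b (f k).1 (f k).2)).
    by move=> k; case: (Hab (f k).1).
  move=> x [k _ Ekx]; have [_ /(_ _ Ekx)[j _ Gx] _] := Hab k.
  by exists (f^-1%FUN (k, j)) => //=; rewrite invK ?inE.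
rewrite nneseries_esumT //.
rewrite -(@reindex_esum _ _ _ [set: nat] [set: nat * nat] f len) //.
rewrite (_ : \esum_(i in setT) len i =
    \sum_(0 <= i <oo) \sum_(0 <= j <oo) len (i, j)); last first.
  rewrite nneseries_esumT; last by move=> k; exact: nneseries_ge0.
  transitivity (\esum_(i in [set: nat]) \esum_(j in [set: nat]) len (i, j)).
    rewrite esum_esum //; congr esum.
    by rewrite predeqE.
  by apply: eq_esum => k _; rewrite nneseries_esumT.
apply: lee_nneseries => [k _ _|k _]; first exact: nneseries_ge0.
by case: (Hab k).
Qed.

Hypothesis n_gt0 : (0 < n)%N.

Lemma volume_box_le a b E : (forall i, a i 0 <= b i 0)%R -> E `<=` box a b ->
  volume E <= (\prod_i (b i 0 - a i 0))%:E.
Proof.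
move=> ab Eab.
(* Every box after the first is [box a a], whose side product is 0 because [0 < n]. *)
pose b' k := if k is 0%N then b else a.
have := @volume_le_cover (fun=> a) b' E.
rewrite nneseries_recl //; last first.
  by move=> k _; rewrite lee_fin prodr_ge0 // => i _; case: k => [|k]; rewrite subr_ge0.
rewrite eseries0 ?adde0; last first.
  by case=> // k _ _ /=; rewrite (bigD1 (Ordinal n_gt0)) //= subrr mul0r //.
apply=> [k i|x /Eab xab]; last by exists 0%N.
by case: k.
Qed.

Lemma volume0 : volume (set0 : set 'cV[R]_n) = 0.
Proof.
apply/eqP; rewrite eq_le volume_ge0 andbT.
have := @volume_box_le 0 0 set0 (fun i => lexx _) (@sub0set _ _).
by rewrite (bigD1 (Ordinal n_gt0)) //= subrr mul0r.
Qed.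

Lemma volumeU E F : volume (E `|` F) <= volume E + volume F.
Proof.
pose G k := match k with 0%N => E | 1%N => F | _ => set0 end.
have -> : E `|` F = \bigcup_k G k.
  rewrite predeqE => x; split => [[|] h|[[|[|k]] _ //= h]].
  - by exists 0%N.
  - by exists 1%N.
  - by left.
  - by right.
apply: le_trans (volume_sigma_subadditive _) _.
rewrite (nneseries_split 0 2); last by move=> k _; exact: volume_ge0.
rewrite eseries0 ?adde0; last by move=> [|[|k]] //= _ _; exact: volume0.
by rewrite !big_nat_recl //= big_geq // adde0.
Qed.

(** The images of the boxes of a covering of [E] cover the image of [E], so subadditivity extends a
    bound from boxes to all sets. *)
Lemma volume_image_le (T : 'cV[R]_n -> 'cV[R]_n) (c : R) : (0 < c)%R ->
  (forall a b, (forall i, a i 0 <= b i 0)%R ->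
    volume (T @` box a b) <= (c * \prod_i (b i 0 - a i 0))%:E) ->
  forall E, volume (T @` E) <= c%:E * volume E.
Proof.
move=> c0 Tbox E.
rewrite -lee_pdivrMl //.
apply: le_ereal_inf_tmp => _ [[a b] /= [ab Eab] <-].
rewrite lee_pdivrMl //.
apply: le_trans (_ : volume (\bigcup_k (T @` box (a k) (b k))) <= _).
  apply: le_volume => _ [x /Eab[k _ xk] <-]; exists k => //; exact: imageP.
apply: le_trans (volume_sigma_subadditive _) _.
rewrite -nneseriesZl; last first.
  by move=> k _; rewrite lee_fin prodr_ge0 // => i _; rewrite subr_ge0.
apply: lee_nneseries => [k _ _|k _]; first exact: volume_ge0.
by rewrite -EFinM; exact: Tbox.
Qed.

Lemma volume_translate_le E (c : 'cV[R]_n) :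
  volume [set x + c | x in E]%R <= volume E.
Proof.
rewrite -[leRHS]mul1e; apply: volume_image_le => // a b ab; rewrite mul1r.
have -> : (\prod_i (b i 0 - a i 0) = \prod_i ((b + c)%R i 0 - (a + c)%R i 0))%R.
  by apply: eq_bigr => i _; rewrite !mxE; ring.
apply: volume_box_le => [i|_ [x xab <-] i]; rewrite !mxE ?lerD2r //.
by rewrite ltrD2r.
Qed.

(* Halving the box in direction j halves the excess |c| (b_j - a_j) of the
   bounding box of each sheared piece; m-fold halving leaves a factor 2^-m. *)
Lemma volume_shear_box (i j : 'I_n) (c : R) a b : i != j ->
  (forall k, a k 0 <= b k 0)%R ->
  volume (mulmx (elementary_mx i j c) @` box a b) <=
  (\prod_k (b k 0 - a k 0))%:E.
Proof.
move=> ij ab.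
pose P (a b : 'cV[R]_n) := (\prod_(k | (k != i) && (k != j)) (b k 0 - a k 0))%R.
have P0 a' b' : (forall k, a' k 0 <= b' k 0)%R -> (0 <= P a' b')%R.
  by move=> h; apply: prodr_ge0 => k _; rewrite subr_ge0.
have addE (u v : 'cV[R]_n) k : ((u + v)%R k 0 = u k 0 + v k 0)%R by rewrite mxE.
have prodE a' b' : (\prod_k (b' k 0 - a' k 0) =
    P a' b' * (b' j 0 - a' j 0) * (b' i 0 - a' i 0))%R.
  by rewrite (bigD1 i) //= (bigD1 j) /=; [rewrite mulrC (mulrC _ (P _ _))|rewrite eq_sym].
have approx (m : nat) : forall a b, (forall k, a k 0 <= b k 0)%R ->
    volume (mulmx (elementary_mx i j c) @` box a b) <=
    (P a b * (b j 0 - a j 0) *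
     (b i 0 - a i 0 + 2 * `|c| * (b j 0 - a j 0) / 2 ^+ m))%:E.
  elim: m => [|m IH] {ab}a {}b ab.
    (* The shear moves coordinate [i] by [c * x j 0], which stays within [d] of [c * a j 0]; the
       bounding box therefore has side [b i 0 - a i 0 + 2 * d] in direction [i]. *)
    set d := (`|c| * (b j 0 - a j 0))%R.
    have d0 : (0 <= d)%R by rewrite mulr_ge0 // subr_ge0.
    pose sh s : 'cV[R]_n := (\col_k if k == i then c * a j 0 + s * d else 0)%R.
    have shj s : (sh s j 0 = 0)%R by rewrite mxE eq_sym (negbTE ij).
    have shi s : (sh s i 0 = c * a j 0 + s * d)%R by rewrite mxE eqxx.
    have shk s k : k != i -> (sh s k 0 = 0)%R by move=> ki; rewrite mxE (negbTE ki).
    apply: le_trans (volume_box_le (a := a + sh (-1)) (b := b + sh 1) _ _)%R _.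
    - move=> k; have [->|ki] := eqVneq k i.
        rewrite !addE !shi; have := ab i; nra.
      by rewrite !addE !shk // !addr0.
    - move=> _ [x xab <-] k; rewrite elementary_mxE.
      have [->|ki] := eqVneq k i; last first.
        by rewrite !addE !shk // mul0r !addr0.
      rewrite !addE !shi mulr1n.
      have : (`|c * (x j 0 - a j 0)| <= d)%R.
        rewrite normrM ler_wpM2l // ger0_norm; have := xab j; lra.
      rewrite ler_norml; have := xab i; lra.
    rewrite lee_fin prodE.
    have -> : P (a + sh (-1))%R (b + sh 1)%R = P a b.
      by apply: eq_bigr => k /andP[ki _]; rewrite !addE !shk // !addr0.
    rewrite !addE !shi !shj /d !addr0 expr0 divr1.
    by rewrite le_eqVlt; apply/orP; left; apply/eqP; ring.
  pose h := ((a j 0 + b j 0) / 2)%R.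
  pose upd (v : 'cV[R]_n) : 'cV[R]_n := (\col_k if k == j then h else v k 0)%R.
  have updj v : (upd v j 0 = h)%R by rewrite mxE eqxx.
  have updk v k : k != j -> (upd v k 0 = v k 0)%R by move=> kj; rewrite mxE (negbTE kj).
  have abj := ab j.
  have h1 : forall k, (a k 0 <= upd b k 0)%R.
    by move=> k; have [->|kj] := eqVneq k j; rewrite ?updj ?updk // /h; lra.
  have h2 : forall k, (upd a k 0 <= b k 0)%R.
    by move=> k; have [->|kj] := eqVneq k j; rewrite ?updj ?updk // /h; lra.
  apply: le_trans (_ : volume (mulmx (elementary_mx i j c) @` box a (upd b) `|`
                               mulmx (elementary_mx i j c) @` box (upd a) b) <= _).
    apply: le_volume => _ [x xab <-].
    have [xh|hx] := (leP (x j 0) h)%R; [left|right]; apply: imageP => k;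
      have [->|kj] := eqVneq k j; rewrite ?updj ?updk //.
    - by have /andP[-> _] := xab j.
    - by have /andP[_ ->] := xab j; rewrite hx.
  apply: le_trans (volumeU _ _) _.
  apply: le_trans (leeD (IH _ _ h1) (IH _ _ h2)) _.
  have -> : P a (upd b) = P a b by apply: eq_bigr => k /andP[_ kj]; rewrite updk.
  have -> : P (upd a) b = P a b by apply: eq_bigr => k /andP[_ kj]; rewrite updk.
  rewrite -EFinD lee_fin !updj !updk // /h exprS.
  rewrite le_eqVlt; apply/orP; left; apply/eqP; field.
  by rewrite expf_neq0.
rewrite prodE.
set A := (P a b * (b j 0 - a j 0))%R; set B := (b i 0 - a i 0)%R.
set C := (2 * `|c| * (b j 0 - a j 0))%R.
have A0 : (0 <= A)%R by rewrite mulr_ge0 ?P0 // subr_ge0.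
have C0 : (0 <= C)%R by rewrite !mulr_ge0 // subr_ge0.
apply/lee_addgt0Pr => e e0.
have AC0 : (0 <= A * C / e)%R := divr_ge0 (mulr_ge0 A0 C0) (ltW e0).
(* Since [m < 2 ^ m], the excess [A * C / 2 ^ m] is at most [e]. *)
pose m := Num.bound (A * C / e)%R; have hm : (A * C / e < m%:R)%R := archi_boundP AC0.
apply: le_trans (approx m a b ab) _; rewrite -EFinD lee_fin mulrDr lerD2l.
have m2 : (0 < 2 ^+ m :> R)%R by rewrite exprn_gt0.
rewrite mulrA ler_pdivrMr // -ler_pdivrMl // mulrC.
apply/ltW/(lt_le_trans hm).
by rewrite -natrX ler_nat ltnW // ltn_expl.
Qed.

Lemma volume_scale_box (i : 'I_n) (c : R) a b : (1 + c != 0)%R ->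
  (forall k, a k 0 <= b k 0)%R ->
  volume (mulmx (elementary_mx i i c) @` box a b) <=
  (`|1 + c| * \prod_k (b k 0 - a k 0))%:E.
Proof.
move=> c0 ab.
pose P := (\prod_(k | k != i) (b k 0 - a k 0))%R.
have P0 : (0 <= P)%R by apply: prodr_ge0 => k _; rewrite subr_ge0.
apply/lee_addgt0Pr => e e0.
(* Boxes are open on the left and closed on the right, and a negative [1 + c] swaps the two sides.
   Lowering the left end by [d] keeps the closed end inside, at a cost of [d * P <= e]. *)
pose d := (e / (P + 1))%R.
have d0 : (0 < d)%R by rewrite divr_gt0 // ltr_wpDl.
pose lo := Num.min ((1 + c) * a i 0)%R ((1 + c) * b i 0)%R.
pose a' : 'cV[R]_n := (\col_k if k == i then lo - d else a k 0)%R.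
pose b' : 'cV[R]_n := (\col_k if k == i then lo + `|1 + c| * (b i 0 - a i 0) else b k 0)%R.
have l0 : (0 <= `|1 + c| * (b i 0 - a i 0))%R by rewrite mulr_ge0 // subr_ge0.
apply: le_trans (volume_box_le (a := a') (b := b') _ _)%R _.
- by move=> k; rewrite !mxE; case: ifP => // _; lra.
- move=> _ [x xab <-] k; rewrite elementary_mxE !mxE.
  case: ifP => [/eqP ->|ki]; last by rewrite mul0r addr0.
  have /andP[x1 x2] := xab i; rewrite mulr1n /lo.
  have [cp|cn] := (leP 0 (1 + c))%R.
    have h1 := ler_wpM2l cp (ltW x1); have h2 := ler_wpM2l cp x2.
    by rewrite min_l ?(le_trans h1 h2) // ger0_norm //; apply/andP; split; lra.
  have h1 := ler_wnM2l (ltW cn) (ltW x1); have h2 := ler_wnM2l (ltW cn) x2.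
  by rewrite min_r ?(le_trans h2 h1) // ltr0_norm //; apply/andP; split; lra.
rewrite (bigD1 i) //= [in leRHS](bigD1 i) //= -/P -EFinD lee_fin.
have -> : (\prod_(k < n | k != i) (b' k 0 - a' k 0) = P)%R.
  by apply: eq_bigr => k ki; rewrite !mxE (negbTE ki).
rewrite !mxE eqxx.
have : (d * P <= e)%R.
  rewrite /d mulrAC ler_pdivrMr ?ltr_wpDl //; nra.
nra.
Qed.

Lemma volume_elementary_le i j (c : R) E : (\det (elementary_mx i j c) != 0)%R ->
  volume (mulmx (elementary_mx i j c) @` E) <=
  (`|\det (elementary_mx i j c)|)%:E * volume E.
Proof.
move=> d0; apply: volume_image_le; first by rewrite normr_gt0.
move=> a b ab; move: d0; rewrite det_elementary_mx.
have [->|ij] := eqVneq i j; first by move=> d0; exact: volume_scale_box.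
by move=> _; rewrite addr0 normr1 mul1r; exact: volume_shear_box.
Qed.

Lemma volume_linear_image_le (A : 'M[R]_n) E : A \in unitmx ->
  volume (linear_image A E) <= (`|\det A|)%:E * volume E.
Proof.
pose P (B : 'M[R]_n) := forall E, volume (linear_image B E) <= (`|\det B|)%:E * volume E.
move=> Au; apply: (@unitmx_elementary_ind _ _ P) A Au E; rewrite {}/P.
- move=> E; rewrite det1 normr1 mul1e; apply: le_volume => _ [x Ex <-].
  by rewrite mul1mx.
- by move=> i j c d0 E; exact: volume_elementary_le.
- move=> B C hB hC E; rewrite det_mulmx normrM EFinM -muleA.
  apply: le_trans (_ : volume (linear_image B (linear_image C E)) <= _).
    by apply: le_volume => _ [x Ex <-]; exists (C *m x)%R; [exists x|rewrite mulmxA].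
  by apply: le_trans (hB _) _; apply: lee_wpmul2l; rewrite ?lee_fin.
Qed.

Lemma volume_linear_image (A : 'M[R]_n) E : A \in unitmx ->
  volume (linear_image A E) = (`|\det A|)%:E * volume E.
Proof.
move=> Au; apply/eqP; rewrite eq_le volume_linear_image_le //=.
have dA : (0 < `|\det A|)%R by rewrite normr_gt0 -unitfE -unitmxE.
rewrite -lee_pdivlMl // -normfV -det_inv.
apply: le_trans (volume_linear_image_le _ _); last by rewrite unitmx_inv.
apply: le_volume => x Ex; exists (A *m x)%R; first by exists x.
by rewrite mulKmx.
Qed.

(* On the cube, 1 <= sum_k prod_i 1_{]a_k i, b_k i]}(x_i); integrating over one
   coordinate at a time replaces the indicators by the side lengths. *)
Lemma cube_le_cover (s : R) (c : 'cV[R]_n) (a b : nat -> 'cV[R]_n) : (0 < s)%R ->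
  (forall k i, a k i 0 <= b k i 0)%R ->
  [set x : 'cV[R]_n | forall i, (c i 0 <= x i 0 <= c i 0 + s)%R] `<=`
    \bigcup_k box (a k) (b k) ->
  (s ^+ n)%:E <= \sum_(0 <= k <oo) (\prod_i (b k i 0 - a k i 0))%:E.
Proof.
move=> s0 ab cov.
pose G (x : 'cV[R]_n) k (i : 'I_n) : R :=
  \1_([set` `]a k i 0%R, b k i 0%R]]) (x i 0%R).
pose L k (i : 'I_n) : R := (b k i 0 - a k i 0)%R.
have G0 x k i : (0 <= G x k i)%R by rewrite /G indicE.
have L0 k i : (0 <= L k i)%R by rewrite subr_ge0.
(* The coordinates below [j] have been integrated out: [j = 0] is the pointwise covering statement
   and [j = n] the conclusion. *)
suff claim j (x : 'cV[R]_n) : (j <= n)%N -> (forall i, c i 0 <= x i 0 <= c i 0 + s)%R ->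
    (s ^+ j)%:E <= \sum_(0 <= k <oo)
      (\prod_(i < n) (if (i < j)%N then L k i else G x k i))%:E.
  have -> : \sum_(0 <= k <oo) (\prod_i (b k i 0 - a k i 0)%R)%:E =
      \sum_(0 <= k <oo) (\prod_(i < n) (if (i < n)%N then L k i else G c k i))%:E.
    apply: eq_eseriesr => k _; congr (_%:E).
    by apply: eq_bigr => i _; rewrite ltn_ord.
  by apply: claim => // i; rewrite lexx lerDl ltW.
elim: j x => [|j IH] x jn xc.
  have [k _ xk] := cov x xc.
  rewrite (@nneseriesD1 _ _ k) //; last first.
    by move=> k' _; rewrite lee_fin prodr_ge0.
  rewrite -[leLHS]adde0; apply: leeD; last first.
    by apply: nneseries_ge0 => k' _ _; rewrite lee_fin prodr_ge0.
  rewrite lee_fin big1 // => i _; rewrite /G indicE mem_set //=.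
  by rewrite in_itv /= xk.
pose jo := Ordinal jn.
pose y t : 'cV[R]_n := (\col_i if i == jo then t else x i 0)%R.
pose C k := (\prod_(i < n | i != jo) (if (i < j)%N then L k i else G x k i))%R.
have C0 k : (0 <= C k)%R by apply: prodr_ge0 => i _; case: ifP.
pose D : set (measurableTypeR R) := [set` `[c jo 0%R, (c jo 0 + s)%R]].
have mD : measurable D by exact: measurable_itv.
pose f k (t : measurableTypeR R) : \bar R :=
  (C k)%:E * (\1_([set` `]a k jo 0%R, b k jo 0%R]]) t)%:E.
have Cf t : D t -> (s ^+ j)%:E <= \sum_(0 <= k <oo) f k t.
  rewrite /D /= in_itv /= => Dt.
  apply: le_trans (IH (y t) (ltnW jn) _) _.
    by move=> i; rewrite mxE; case: eqP => [->|].
  rewrite le_eqVlt; apply/orP; left; apply/eqP.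
  apply: eq_eseriesr => k _; rewrite /f -EFinM; congr (_%:E).
  rewrite (bigD1 jo) //= ltnn mulrC /G mxE eqxx; congr (_ * _)%R.
  apply: eq_bigr => i ij; rewrite mxE (negbTE ij) //.
have f0 k t : 0 <= f k t by rewrite mule_ge0 // lee_fin.
have mf k : measurable_fun D (f k).
  apply: measurable_funeM; apply/measurable_EFinP.
  exact: measurable_indic.
have muD : lebesgue_measure D = s%:E.
  rewrite /D lebesgue_measure_itv /= lte_fin ltrDl s0 -EFinB.
  by congr (_%:E); ring.
have If k : \int[lebesgue_measure]_(t in D) f k t <=
    (C k * L k jo)%:E.
  rewrite ge0_integralZl_EFin //; last exact/measurable_EFinP/measurable_indic.
  rewrite integral_indic // EFinM; apply: lee_wpmul2l; first by rewrite lee_fin.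
  apply: le_trans (le_measure _ _ _ (@subIsetl _ _ _)) _; rewrite ?inE //.
    exact: measurableI.
  rewrite /= lebesgue_measure_itv /=; case: ifP => _; first by rewrite -EFinB.
  by rewrite lee_fin.
(* The case [j] is integrated over coordinate [jo] along a segment of length [s]; nonnegativity of
   the terms allows sum and integral to be exchanged. *)
rewrite exprSr EFinM -muD -integral_cst //.
apply: (@le_trans _ _ (\int[lebesgue_measure]_(t in D) \sum_(0 <= k <oo) f k t)).
  apply: ge0_le_integral => //.
  - by move=> t _ /=; rewrite lee_fin exprn_ge0 // ltW.
  - by apply: ge0_emeasurable_sum => // k t _ _.
rewrite integral_nneseries //; apply: lee_nneseries => [k _ _|k _].
  by apply: integral_ge0.
apply: le_trans (If k) _; rewrite lee_fin (bigD1 jo) //= ltnSn mulrC.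
rewrite le_eqVlt; apply/orP; left; apply/eqP; congr (_ * _)%R.
apply: eq_bigr => i ij; rewrite ltnS [(i < j)%N]ltn_neqAle.
by rewrite (_ : (i != j :> nat) = true).
Qed.

Lemma volume_gt0 (c : 'cV[R]_n) (s : R) E : (0 < s)%R ->
  [set x : 'cV[R]_n | forall i, (c i 0 <= x i 0 <= c i 0 + s)%R] `<=` E ->
  0 < volume E.
Proof.
move=> s0 cE; apply: (@lt_le_trans _ _ (s ^+ n)%:E).
  by rewrite lte_fin exprn_gt0.
apply: le_ereal_inf_tmp => _ [[a b] /= [ab Eab] <-].
exact: (cube_le_cover s0 ab (subset_trans cE Eab)).
Qed.

Lemma volume_lt_pinfty (M : R) E :
  E `<=` [set x : 'cV[R]_n | forall i, (`|x i 0| <= M)%R] -> volume E < +oo.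
Proof.
(* Boxes omit their left faces, hence the extra [- 1]; the absolute value covers a negative [M]. *)
move=> EM; pose a : 'cV[R]_n := const_mx (- `|M| - 1)%R.
pose b : 'cV[R]_n := const_mx `|M|%R.
apply: (@le_lt_trans _ _ (\prod_i (b i 0 - a i 0)%R)%:E); last by rewrite ltry.
apply: volume_box_le => // [i|x /EM xM i]; rewrite !mxE.
  by have := normr_ge0 M; lra.
have := xM i; rewrite ler_norml => /andP[h1 h2]; have := ler_norm M; lra.
Qed.

End Volume.

(** * Continuity and compactness for matrices *)

Section MatrixTopology.
Variable R : realType.

Lemma sum_continuous (T : topologicalType) (I : finType) (f : I -> T -> R) :
  (forall i, continuous (f i)) -> continuous (fun x => \sum_i f i x).
Proof.
by move=> cf; apply: continuous_big => // -[x y]; exact: add_continuous.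
Qed.

Lemma product_continuous (T : topologicalType) (f g : T -> R) :
  continuous f -> continuous g -> continuous (fun x => f x * g x).
Proof. by move=> cf cg x; exact: cvgM (cf x) (cg x). Qed.

Lemma difference_continuous (T : topologicalType) (f g : T -> R) :
  continuous f -> continuous g -> continuous (fun x => f x - g x).
Proof. by move=> cf cg x; exact: cvgB (cf x) (cg x). Qed.

Lemma norm_comp_continuous (T : topologicalType) (f : T -> R) :
  continuous f -> continuous (fun x => `|f x|).
Proof. by move=> cf x; exact: cvg_norm (cf x). Qed.

Lemma mx_continuous (T : topologicalType) m n (f : T -> 'M[R]_(m, n)) :
  (forall i j, continuous (fun x => f x i j)) -> continuous f.
Proof.
move=> cf x A [P Pf PA].
have : \forall y \near x, forall ij : 'I_m * 'I_n, P ij.1 ij.2 (f y ij.1 ij.2).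
  by apply: filter_forall => -[i j]; exact: (cf i j x).
by apply: filterS => y Py; apply: PA => i j; exact: (Py (i, j)).
Qed.

Lemma entry_continuous m n (i : 'I_m) (j : 'I_n) :
  continuous (fun M : 'M[R]_(m, n) => M i j).
Proof. exact: coord_continuous. Qed.

Lemma trace_continuous n : continuous (@mxtrace R n).
Proof. by apply: sum_continuous => i; exact: entry_continuous. Qed.

Lemma mulmx_continuous m n p (T : topologicalType) (f : T -> 'M[R]_(m, n))
    (g : T -> 'M[R]_(n, p)) :
  continuous f -> continuous g -> continuous (fun x => f x *m g x).
Proof.
move=> cf cg; apply: mx_continuous => i j.
under eq_fun do rewrite mxE.
apply: sum_continuous => k x; apply: cvgM.
  exact: (continuous_comp (cf x) (@entry_continuous _ _ i k (f x))).
exact: (continuous_comp (cg x) (@entry_continuous _ _ k j (g x))).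
Qed.

Lemma trmx_continuous m n : continuous (@trmx R m n).
Proof.
apply: mx_continuous => i j; under eq_fun do rewrite mxE.
exact: entry_continuous.
Qed.

Lemma entry_le_norm m n (M : 'M[R]_(m, n)) i j : `|M i j| <= `|M|.
Proof.
rewrite [leRHS]/Num.Def.normr /= mx_normrE.
exact: (le_bigmax _ (fun ij : 'I_m * 'I_n => `|M ij.1 ij.2|) (i, j)).
Qed.

Lemma closed_bounded_compact n (A : set 'cV[R]_n) (M : R) :
  closed A -> (forall x, A x -> forall i, `|x i 0| <= M) -> compact A.
Proof.
(* Transposition passes to row vectors, where [rV_compact] makes a product of segments compact. *)
move=> Acl AM; pose B : set 'rV[R]_n := trmx @^-1` A.
have -> : A = trmx @` B.
  rewrite predeqE => x; split=> [Ax|[y By <-]] //.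
  by exists x^T; rewrite /B /= trmxK.
apply: continuous_compact; first exact/continuous_subspaceT/trmx_continuous.
have Kc : compact [set v : 'rV[R]_n | forall i, `[-M, M]%classic (v ord0 i)].
  by apply: (@rV_compact R n (fun=> `[-M, M]%classic)) => i; exact: segment_compact.
apply: subclosed_compact _ Kc _.
- exact: (continuous_closedP _).1 (@trmx_continuous _ _) _ Acl.
- move=> y By i /=; rewrite in_itv /= -ler_norml.
  by have := AM _ By i; rewrite mxE.
Qed.

Lemma compact_image2 (S T U : topologicalType) (f : S * T -> U) A B :
  continuous f -> compact A -> compact B ->
  compact [set f (x, y) | x in A & y in B].
Proof.
move=> cf cA cB.
have -> : [set f (x, y) | x in A & y in B] = f @` (A `*` B).
  rewrite predeqE => z; split=> [[x Ax [y By <-]]|[[x y] [/= Ax By] <-]].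
    by exists (x, y).
  by exists x => //; exists y.
by apply: continuous_compact; [exact: continuous_subspaceT|exact: compact_setX].
Qed.

End MatrixTopology.

(** * Dot product, quadratic forms and the unit sphere *)

Section DotProduct.
Variables (R : realType) (n : nat).
Implicit Types (x y u v : 'cV[R]_n) (A B : 'M[R]_n) (a : R).

Lemma dotE x y : dot x y = \sum_i x i 0 * y i 0.
Proof. by rewrite /dot mxE; apply: eq_bigr => i _; rewrite mxE. Qed.

Lemma dotC x y : dot x y = dot y x.
Proof. by rewrite !dotE; apply: eq_bigr => i _; rewrite mulrC. Qed.

Lemma dotDl x y u : dot (x + y) u = dot x u + dot y u.
Proof. by rewrite /dot linearD mulmxDl mxE. Qed.

Lemma dotZl a x u : dot (a *: x) u = a * dot x u.
Proof. by rewrite /dot linearZ -scalemxAl mxE. Qed.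

Lemma dotNl x u : dot (- x) u = - dot x u.
Proof. by rewrite -scaleN1r dotZl mulN1r. Qed.

Lemma dotBl x y u : dot (x - y) u = dot x u - dot y u.
Proof. by rewrite dotDl dotNl. Qed.

Lemma dotDr x y u : dot u (x + y) = dot u x + dot u y.
Proof. by rewrite ![dot u _]dotC dotDl. Qed.

Lemma dotZr a x u : dot u (a *: x) = a * dot u x.
Proof. by rewrite ![dot u _]dotC dotZl. Qed.

Lemma dotNr x u : dot u (- x) = - dot u x.
Proof. by rewrite ![dot u _]dotC dotNl. Qed.

Lemma dotBr x y u : dot u (x - y) = dot u x - dot u y.
Proof. by rewrite dotDr dotNr. Qed.

Lemma dot0l u : dot 0 u = 0.
Proof. by rewrite -(scale0r 0) dotZl mul0r. Qed.

Lemma dot_mulmxl A x y : dot (A *m x) y = dot x (A^T *m y).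
Proof. by rewrite /dot trmx_mul mulmxA. Qed.

Lemma dot_ge0 x : 0 <= dot x x.
Proof. by rewrite dotE sumr_ge0 // => i _; rewrite -expr2 sqr_ge0. Qed.

Lemma sqr_entry_le_dot x i : x i 0 ^+ 2 <= dot x x.
Proof.
rewrite dotE (bigD1 i) //= -expr2 lerDl sumr_ge0 // => j _.
by rewrite -expr2 sqr_ge0.
Qed.

Lemma dot_eq0 x : (dot x x == 0) = (x == 0).
Proof.
apply/eqP/eqP => [x0|->]; last exact: dot0l.
apply/matrixP => i j; rewrite ord1 mxE; apply/eqP.
by rewrite -sqrf_eq0 eq_le sqr_ge0 andbT -x0 sqr_entry_le_dot.
Qed.

Lemma dot_gt0 x : x != 0 -> 0 < dot x x.
Proof. by move=> x0; rewrite lt_def dot_eq0 x0 dot_ge0. Qed.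

Lemma cauchy_schwarz x y : dot x y ^+ 2 <= dot x x * dot y y.
Proof.
have [->|y0] := eqVneq y 0.
  by rewrite dotC !dot0l expr0n mulr0.
have := dot_ge0 (dot y y *: x - dot x y *: y).
rewrite !(dotBl, dotBr, dotZl, dotZr) (dotC y x).
have := dot_gt0 y0; nra.
Qed.

Lemma unit_sphereE u : unit_sphere u <-> dot u u = 1.
Proof.
rewrite /unit_sphere /=; split=> [u1|->]; last exact: sqrtr1.
by rewrite -[LHS]sqr_sqrtr ?dot_ge0 // u1 expr1n.
Qed.

Lemma unit_ballE x : unit_ball x <-> dot x x <= 1.
Proof.
rewrite /unit_ball /= -{1}[1]sqrtr1 ler_sqrt ?ltr01 //.
Qed.

Lemma norm_entry_le1 x i : dot x x <= 1 -> `|x i 0| <= 1.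
Proof.
move=> x1; rewrite -[leRHS]normr1 -ler_sqr ?nnegrE // !real_normK ?num_real // expr1n.
exact: le_trans (sqr_entry_le_dot _ _) x1.
Qed.

Lemma unit_sphere_normalize x : x != 0 ->
  unit_sphere ((Num.sqrt (dot x x))^-1 *: x).
Proof.
move=> x0; apply/unit_sphereE; rewrite dotZl dotZr mulrA -invfM -expr2.
by rewrite sqr_sqrtr ?dot_ge0 // mulVf // dot_eq0.
Qed.

Lemma trace_rank_one x : \tr (x *m x^T) = dot x x.
Proof. by rewrite mxtrace_mulC [x^T *m x]mx11_scalar mxtrace_scalar. Qed.

Lemma trace_mul_rank_one A x : \tr (A *m (x *m x^T)) = quad A x.
Proof.
by rewrite mulmxA mxtrace_mulC mulmxA [_ *m x]mx11_scalar mxtrace_scalar.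
Qed.

Lemma quad_tr A x : quad A^T x = quad A x.
Proof.
rewrite /quad (_ : x^T *m A^T *m x = (x^T *m A *m x)^T) 1?mxE //.
by rewrite !trmx_mul trmxK mulmxA.
Qed.

Lemma dot_continuousl u : continuous (fun x => dot x u).
Proof.
under eq_fun do rewrite dotE; apply: sum_continuous => i.
apply: product_continuous; first exact: entry_continuous.
exact: cst_continuous.
Qed.

Lemma dot_diag_continuous : continuous (fun x : 'cV[R]_n => dot x x).
Proof.
under eq_fun do rewrite dotE; apply: sum_continuous => i.
by apply: product_continuous; exact: entry_continuous.
Qed.

Lemma quad_continuous A : continuous (quad A).
Proof.
have cq : continuous (fun x => x^T *m A *m x).
  apply: mulmx_continuous; last by move=> y; exact: cvg_id.
  apply: mulmx_continuous.
    exact: trmx_continuous.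
  exact: cst_continuous.
by move=> x; exact: (continuous_comp (cq x) (@entry_continuous R 1 1 0 0 _)).
Qed.

Lemma closed_unit_sphere : closed (@unit_sphere R n).
Proof.
rewrite (_ : @unit_sphere R n = [set x | dot x x = 1]); last first.
  by rewrite predeqE => x; exact: unit_sphereE.
exact: (continuous_closedP _).1 dot_diag_continuous _ (@closed_eq _ (1 : R)).
Qed.

Lemma compact_sub_sphere (W : set 'cV[R]_n) :
  closed W -> W `<=` @unit_sphere R n -> compact W.
Proof.
move=> Wcl W1; apply: (closed_bounded_compact (M := 1) Wcl) => x /W1/unit_sphereE x1 i.
by apply: norm_entry_le1; rewrite x1.
Qed.

End DotProduct.

(** The obtuse angle criterion for the projection of [P] onto [S], in the inner product
    [tr (A^T B)]. Rectangular matrices make it serve both for square matrices in [john_dichotomy]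
    and for column vectors in [mem_of_dot_le_support]. *)
Lemma nearest_point (R : realType) m n (S : set 'M[R]_(m, n)) (P : 'M[R]_(m, n)) :
  compact S -> S !=set0 ->
  (forall X Y t, S X -> S Y -> 0 <= t <= 1 -> S (X + t *: (Y - X))) ->
  exists X, S X /\ forall Y, S Y -> \tr ((P - X)^T *m (Y - X)) <= 0.
Proof.
move=> cS S0 Sconv.
pose f (Y : 'M[R]_(m, n)) := \tr ((P - Y)^T *m (P - Y)).
have cB : continuous (fun Y : 'M[R]_(m, n) => P - Y).
  apply: mx_continuous => i j; under eq_fun do rewrite !mxE.
  apply: difference_continuous; first exact: cst_continuous.
  exact: entry_continuous.
have cf : continuous f.
  have cq : continuous (fun Y : 'M[R]_(m, n) => (P - Y)^T *m (P - Y)).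
    apply: mulmx_continuous => [Y|//].
    exact: (continuous_comp (cB Y) (@trmx_continuous _ _ _ _)).
  by move=> Y; exact: (continuous_comp (cq Y) (@trace_continuous R _ _)).
have [X /set_mem SX minX] := compact_EVT_min S0 cS (continuous_subspaceT cf).
exists X; split=> // Y SY; rewrite leNgt; apply/negP => a0.
set U := P - X in a0; set Z := Y - X in a0.
set a := \tr _ in a0; pose b := \tr (Z^T *m Z).
have b0 : 0 <= b.
  apply: sumr_ge0 => i _; rewrite mxE; apply: sumr_ge0 => j _.
  by rewrite mxE -expr2 sqr_ge0.
have expand (V Z' : 'M[R]_(m, n)) t : \tr ((V - t *: Z')^T *m (V - t *: Z')) =
    \tr (V^T *m V) - 2 * t * \tr (V^T *m Z') + t ^+ 2 * \tr (Z'^T *m Z').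
  have -> : (V - t *: Z')^T = V^T - t *: Z'^T by rewrite linearB linearZ.
  rewrite mulmxBl !mulmxBr -!scalemxAl -!scalemxAr !raddfB /= !mxtraceZ.
  by rewrite -(mxtrace_tr (Z'^T *m V)) trmx_mul trmxK; ring.
have fE t : f (X + t *: Z) = f X - 2 * t * a + t ^+ 2 * b.
  by rewrite /f (_ : P - (X + t *: Z) = U - t *: Z) ?expand // opprD addrA.
(* Along the segment the squared distance changes by [- 2 t a + t^2 b]; this [t] lies in []0, 1]]
   and satisfies [t b <= a], so the change is at most [- t a < 0]. *)
pose t := a / (a + b).
have ab : 0 < a + b by rewrite ltr_wpDr.
have t0 : 0 < t by rewrite divr_gt0.
have t1 : t <= 1 by rewrite ler_pdivrMr // mul1r lerDl.
have tb : t * b <= a by rewrite /t mulrAC ler_pdivrMr //; nra.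
have /minX : X + t *: Z \in S by apply/mem_set/Sconv => //; rewrite t1 ltW.
rewrite fE; nra.
Qed.

(** * The alternative: a decomposition of the identity or a separating matrix *)

Section Dichotomy.
Variables (R : realType) (n : nat).
Implicit Types (W : set 'cV[R]_n) (X Y : 'M[R]_n).

Lemma rank_one_sumD W k m X Y :
  rank_one_sum W k X -> rank_one_sum W m Y -> rank_one_sum W (k + m) (X + Y).
Proof.
elim: k X => [|k IH] X.
  by case=> l [u [_ _ ->]]; rewrite big_ord0 add0r.
move=> /rank_one_sumS[Z [l [u [Zk l0 Wu ->]]]] Ym; rewrite addSn.
apply/rank_one_sumS; exists (Z + Y), l, u; split=> //; first exact: IH.
by rewrite addrA.
Qed.

Lemma rank_one_sumZ W k X a : 0 <= a -> rank_one_sum W k X -> rank_one_sum W k (a *: X).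
Proof.
move=> a0 [l [u [l0 Wu ->]]]; exists (fun i => a * l i), u; split=> //.
  by move=> i; rewrite mulr_ge0.
by rewrite scaler_sumr; apply: eq_bigr => i _; rewrite scalerA.
Qed.

Lemma rank_one_sum1 W u : W u -> rank_one_sum W 1 (u *m u^T).
Proof.
move=> Wu; exists (fun=> 1), (fun=> u); split=> //.
by rewrite big_ord1 scale1r.
Qed.

Lemma trace_rank_one_sum m (l : 'I_m -> R) (u : 'I_m -> 'cV[R]_n) A :
  \tr (A *m \sum_i l i *: (u i *m (u i)^T)) = \sum_i l i * quad A (u i).
Proof.
rewrite mulmx_sumr linear_sum /=; apply: eq_bigr => i _.
by rewrite -scalemxAr mxtraceZ trace_mul_rank_one.
Qed.

(** The trace of a sum over unit vectors is the sum of its weights, so a trace bound confines each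
    weight to [[0, M]], and [C] is built as a continuous image of compact sets. It may contain sums
    of trace above [M], hence two inclusions instead of an equality. *)
Lemma rank_one_sum_compact W (M : R) m : closed W -> W `<=` @unit_sphere R n ->
  exists C : set 'M[R]_n, [/\ compact C, C `<=` rank_one_sum W m &
    forall X, rank_one_sum W m X -> \tr X <= M -> C X].
Proof.
move=> Wcl W1; have Wc := compact_sub_sphere Wcl W1.
elim: m => [|m [C [Cc CW WC]]].
  exists [set 0]; split; first exact: compact_set1.
    move=> _ ->; exists (fun=> 0), (fun=> 0); split=> [//|[]//|].
    by rewrite big_ord0.
  by move=> X [l [u [_ _ ->]]] _; rewrite big_ord0.
pose f (p : R * 'cV[R]_n) := p.1 *: (p.2 *m p.2^T).
pose g (p : 'M[R]_n * 'M[R]_n) := p.1 + p.2.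
have cf : continuous f.
  apply: mx_continuous => i j.
  rewrite (_ : (fun p => f p i j) = (fun p => p.1 * (p.2 i 0 * p.2 j 0))); last first.
    by apply/funext => p; rewrite /f mxE mxE big_ord1 !mxE.
  have entry2 k : continuous (fun p : R * 'cV[R]_n => p.2 k 0).
    move=> p.
    exact: (continuous_comp (@cvg_snd _ _ _ _ _) (@entry_continuous _ _ _ k 0 p.2)).
  apply: product_continuous; first by move=> p; exact: cvg_fst.
  by apply: product_continuous; exact: entry2.
have cg : continuous g by move=> -[x y]; exact: add_continuous.
exists [set g (t, Y) | t in [set f (l, u) | l in `[0, M]%classic & u in W] & Y in C].
split.
- apply: compact_image2 => //; apply: compact_image2 => //.
  exact: segment_compact.
- move=> _ [_ [l /= l0 [u Wu <-]] [Y CY <-]]; apply/rank_one_sumS.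
  exists Y, l, u; split=> //; first exact: CW.
  by move: l0; rewrite in_itv => /andP[].
- move=> X /rank_one_sumS[Y [l [u [Yk l0 Wu ->]]]].
  rewrite mxtraceD mxtraceZ trace_rank_one; have /unit_sphereE -> := W1 _ Wu.
  rewrite mulr1 => lY.
  have Y0 : 0 <= \tr Y.
    case: Yk => l' [u' [l'0 Wu' ->]]; rewrite -[X in \tr X]mul1mx trace_rank_one_sum.
    apply: sumr_ge0 => i _; apply: mulr_ge0 => //.
    by rewrite /quad mulmx1 -/(dot _ _) dot_ge0.
  exists (f (l, u)).
    by exists l; [rewrite /= in_itv /= l0 (le_trans _ lY) // lerDl|exists u].
  by exists Y => //; apply: WC => //; rewrite (le_trans _ lY) // lerDr.
Qed.

Lemma john_dichotomy W : (0 < n)%N -> closed W -> W `<=` @unit_sphere R n ->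
  W !=set0 ->
  rank_one_sum W 'C(n.+1, 2) 1%:M \/
  exists H c, [/\ 0 < c, forall u, W u -> quad H u <= - c & 0 < \tr H].
Proof.
move=> n0 Wcl W1 W0; set d := 'C(_, _).
have nR : 0 < n%:R :> R by rewrite ltr0n.
pose S : set 'M[R]_n := [set X | rank_one_sum W d X /\ \tr X = n%:R].
have Sc : compact S.
  have [C [Cc CW WC]] := rank_one_sum_compact n%:R d Wcl W1.
  rewrite (_ : S = C `&` [set X | \tr X = n%:R]).
    apply: compact_closedI => //.
    exact: (continuous_closedP _).1 (@trace_continuous R n) _ (@closed_eq _ (n%:R : R)).
  rewrite predeqE => X; split=> [[XW Xn]|[CX Xn]]; split=> //.
    by apply: WC => //; rewrite Xn.
  exact: CW.
have SW u : W u -> S (n%:R *: (u *m u^T)).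
  move=> Wu; split.
    apply: rank_one_sum_caratheodory => //.
    exact: (rank_one_sumZ (ltW nR) (rank_one_sum1 Wu)).
  by rewrite mxtraceZ trace_rank_one; have /unit_sphereE -> := W1 _ Wu; rewrite mulr1.
(* A convex combination has twice as many terms; Caratheodory's reduction brings it back to length
   [d]. *)
have Sconv X Y t : S X -> S Y -> 0 <= t <= 1 -> S (X + t *: (Y - X)).
  move=> [XW Xn] [YW Yn] /andP[t0 t1].
  have -> : X + t *: (Y - X) = (1 - t) *: X + t *: Y.
    by rewrite scalerBr scalerBl scale1r addrA addrAC.
  split; last by rewrite mxtraceD !mxtraceZ Xn Yn -mulrDl subrK mul1r.
  apply: rank_one_sum_caratheodory => //; apply: rank_one_sumD.
    by apply: rank_one_sumZ XW; rewrite subr_ge0.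
  exact: rank_one_sumZ YW.
have trB (A B : 'M[R]_n) : \tr (A - B) = \tr A - \tr B by rewrite raddfB.
have [u0 Wu0] := W0.
have [X [[XW Xn] Xnear]] := nearest_point 1%:M Sc (ex_intro _ _ (SW _ Wu0)) Sconv.
have [X1|X1] := eqVneq X 1%:M; first by left; rewrite -X1.
right; pose H := 1%:M - X; pose f := \tr (H^T *m H).
have f0 : 0 < f.
  have trE : f = \sum_i \sum_j H j i ^+ 2.
    by apply: eq_bigr => i _; rewrite mxE; apply: eq_bigr => j _; rewrite mxE.
  rewrite lt_def trE sumr_ge0 ?andbT; last first.
    by move=> i _; apply: sumr_ge0 => j _; exact: sqr_ge0.
  apply: contra X1; rewrite psumr_eq0 => [/allP H0|i _]; last first.
    by apply: sumr_ge0 => j _; exact: sqr_ge0.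
  rewrite eq_sym -subr_eq0; apply/eqP/matrixP => j i; rewrite [RHS]mxE.
  have := H0 i (mem_index_enum _).
  rewrite /= psumr_eq0 => [/allP H0i|k _]; last exact: sqr_ge0.
  by have := H0i j (mem_index_enum _); rewrite /= sqrf_eq0 => /eqP.
have trH : \tr H = 0 by rewrite /H trB mxtrace1 Xn subrr.
(* The obtuse angle inequality at [Y = n u u^T] gives [n * quad H u <= tr (H^T X)], and this trace
   is [- f] because [tr H = 0]. *)
have quadH u : W u -> n%:R * quad H u <= - f.
  move=> Wu; have := Xnear _ (SW _ Wu); rewrite -/H mulmxBr trB.
  rewrite -scalemxAr mxtraceZ trace_mul_rank_one quad_tr.
  have -> : \tr (H^T *m X) = - f.
    by rewrite /f {3}/H mulmxBr trB mulmx1 mxtrace_tr trH sub0r opprK.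
  by rewrite subr_le0.
(* [H] has trace 0 and [quad H u <= - 2 c] on [W]; adding [c%:M] gives up half of this margin and
   makes the trace positive. *)
pose c := f / (2 * n%:R).
have c0 : 0 < c by rewrite divr_gt0 // mulr_gt0.
exists (H + c%:M), c; split=> //.
- move=> u Wu; have -> : quad (H + c%:M) u = quad H u + c * dot u u.
    by rewrite /quad mulmxDr mulmxDl mxE mul_mx_scalar -scalemxAl [X in _ + X]mxE.
  have /unit_sphereE -> := W1 _ Wu; rewrite mulr1.
  have := quadH _ Wu.
  have -> : f = 2 * n%:R * c by rewrite /c mulrC divfK // mulf_neq0 // gt_eqF.
  by move=> h; rewrite -(ler_pM2l nR); lra.
- by rewrite mxtraceD trH add0r mxtrace_scalar pmulrn_lgt0.
Qed.

End Dichotomy.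

(** * Support function, breadth and width *)

Section Breadth.
Variables (R : realType) (n : nat).
Implicit Types (K L : set 'cV[R]_n) (u v x y : 'cV[R]_n) (A : 'M[R]_n).

(* [support] alone is the support of a function in MathComp, hence [Defs.support]. *)
Definition breadth K u : R := Defs.support K u + Defs.support K (- u).

Lemma support_eq L u (s : R) : (exists2 x, L x & dot x u = s) ->
  (forall x, L x -> dot x u <= s) -> Defs.support L u = s.
Proof.
move=> [x Lx xs] Ls; apply/eqP; rewrite eq_le; apply/andP; split.
  by apply: ge_sup => [|_ [y Ly <-]]; [exists (dot x u); exists x|exact: Ls].
rewrite -xs; apply: ub_le_sup; last by exists x.
by exists s => _ [y Ly <-]; exact: Ls.
Qed.

Lemma support_attained K u : compact K -> K !=set0 ->
  exists2 x, K x & dot x u = Defs.support K u /\ forall y, K y -> dot y u <= Defs.support K u.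
Proof.
move=> cK K0.
have [x /set_mem Kx xmax] := compact_EVT_max K0 cK
  (continuous_subspaceT (@dot_continuousl R n u)).
have xmax' y : K y -> dot y u <= dot x u by move=> Ky; apply: xmax; exact/mem_set.
have sE : Defs.support K u = dot x u by apply: support_eq => //; exists x.
by exists x => //; rewrite sE.
Qed.

Lemma dot_le_support K u x : compact K -> K x -> dot x u <= Defs.support K u.
Proof.
move=> cK Kx; have [y _ [_]] := @support_attained K u cK (ex_intro _ x Kx).
exact.
Qed.

Lemma supportZ K u (a : R) : 0 <= a -> compact K -> K !=set0 ->
  Defs.support K (a *: u) = a * Defs.support K u.
Proof.
move=> a0 cK K0; have [x Kx [xE xmax]] := support_attained u cK K0.
apply: support_eq; first by exists x => //; rewrite dotZr xE.
by move=> y Ky; rewrite dotZr ler_wpM2l // xmax.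
Qed.

Lemma breadthN K u : breadth K (- u) = breadth K u.
Proof. by rewrite /breadth opprK addrC. Qed.

Lemma breadthZ K u (a : R) : 0 <= a -> compact K -> K !=set0 ->
  breadth K (a *: u) = a * breadth K u.
Proof. by move=> a0 cK K0; rewrite /breadth -scalerN !supportZ // mulrDr. Qed.

Lemma breadth_linear_image A K u : breadth (linear_image A K) u = breadth K (A^T *m u).
Proof.
have sE v : Defs.support (linear_image A K) v = Defs.support K (A^T *m v).
  congr sup; rewrite predeqE => t; split=> [[_ [x Kx <-] <-]|[x Kx <-]].
    by exists x => //; rewrite dot_mulmxl.
  by exists (A *m x); [exists x|rewrite dot_mulmxl].
by rewrite /breadth !sE mulmxN.
Qed.

Lemma support_difference_body K u : compact K -> K !=set0 ->
  Defs.support (difference_body K) u = breadth K u.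
Proof.
move=> cK K0; have [x Kx [xE xmax]] := support_attained u cK K0.
have [y Ky [yE ymax]] := support_attained (- u) cK K0.
apply: support_eq => [|_ [x' Kx' [y' Ky' <-]]].
  exists (x - y); first by exists x => //; exists y.
  by rewrite dotBl xE /breadth -yE dotNr.
by rewrite dotBl /breadth -dotNr; apply: lerD; [exact: xmax|exact: ymax].
Qed.

Lemma compact_difference_body K : compact K -> compact (difference_body K).
Proof.
move=> cK; apply: (compact_image2 (f := fun p : 'cV[R]_n * 'cV[R]_n => p.1 - p.2)) => //.
apply: mx_continuous => i j; under eq_fun do rewrite !mxE.
apply: difference_continuous => p.
  exact: (continuous_comp (@cvg_fst _ _ _ _ _) (@entry_continuous _ _ _ i j p.1)).
exact: (continuous_comp (@cvg_snd _ _ _ _ _) (@entry_continuous _ _ _ i j p.2)).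
Qed.

Lemma difference_body_neq0 K : K !=set0 -> difference_body K !=set0.
Proof. by move=> [x Kx]; exists (x - x); exists x => //; exists x. Qed.

Lemma difference_bodyN K x : difference_body K x -> difference_body K (- x).
Proof. by move=> [y Ky [z Kz <-]]; exists z => //; exists y => //; rewrite opprB. Qed.

Lemma breadth_difference_body K u : compact K -> K !=set0 ->
  breadth (difference_body K) u = 2 * breadth K u.
Proof.
move=> cK K0; rewrite {1}/breadth !support_difference_body // breadthN; ring.
Qed.

Lemma breadth_ge0 K u : compact K -> K !=set0 -> 0 <= breadth K u.
Proof.
move=> cK [x Kx]; rewrite -support_difference_body //; last by exists x.
rewrite -(dot0l u); apply: dot_le_support; first exact: compact_difference_body.
by exists x => //; exists x => //; rewrite subrr.
Qed.

Lemma compact_entry_bound K : compact K -> exists M : R,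
  forall x, K x -> forall i, `|x i 0| <= M.
Proof.
move=> /compact_bounded[M [_ MK]]; exists (M + 1) => x Kx i.
apply: le_trans (entry_le_norm x i 0) _.
by apply: MK => //; rewrite ltrDl.
Qed.

(** The breadth is the support function of a bounded set, hence Lipschitz: the maximiser in
    direction [v] also competes in direction [u]. *)
Lemma breadth_continuous K : compact K -> K !=set0 -> continuous (breadth K).
Proof.
move=> cK K0; pose D := difference_body K.
have cD := compact_difference_body cK; have D0 := difference_body_neq0 K0.
have [M DM] := compact_entry_bound cD.
pose g u v := \sum_i M * `|v i 0 - u i 0|.
have gB u v : breadth K v <= breadth K u + g u v.
  rewrite -!support_difference_body //.
  have [x Dx [<- _]] := support_attained v cD D0.
  have -> : dot x v = dot x u + dot x (v - u) by rewrite dotBr addrC subrK.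
  apply: lerD; first exact: dot_le_support.
  rewrite dotE; apply: ler_sum => i _; rewrite !mxE.
  apply: le_trans (ler_norm _) _; rewrite normrM.
  by apply: ler_wpM2r => //; exact: DM.
have gC u v : g u v = g v u by apply: eq_bigr => i _; rewrite distrC.
have cg u : continuous (g u).
  apply: sum_continuous => i; apply: product_continuous; first exact: cst_continuous.
  apply/norm_comp_continuous/difference_continuous; first exact: entry_continuous.
  exact: cst_continuous.
suff H (u : 'cV[R]_n) : breadth K v @[v --> u] --> breadth K u by move=> u; exact: H.
apply: (@cvgrPdist_lt _ _ _ _ (nbhs_filter u) _ _).2 => e e0.
have := (@cvgrPdist_lt _ _ _ _ (nbhs_filter u) _ _).1 (cg u u) e e0.
apply: filterS => v.
have -> : g u u = 0 by apply: big1 => i _; rewrite subrr normr0 mulr0.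
rewrite sub0r normrN => ge; rewrite ltr_norml.
have := gB u v; have := gB v u; rewrite (gC v u).
have := ler_norm (g u v); lra.
Qed.

Lemma width_le K u : (forall v, 0 <= breadth K v) -> unit_sphere u ->
  width K <= breadth K u.
Proof.
move=> K0 u1; apply: ge_inf; last by exists u.
by exists 0 => _ [v _ <-]; exact: K0.
Qed.

Lemma unit_sphere_neq0 : (0 < n)%N -> @unit_sphere R n !=set0.
Proof.
move=> n0; exists (delta_mx (Ordinal n0) 0); apply/unit_sphereE.
rewrite dotE (bigD1 (Ordinal n0)) //= big1 => [|i i0]; rewrite !mxE ?eqxx.
  by rewrite mulr1 addr0.
by rewrite (negbTE i0) mul0r.
Qed.

Lemma le_width K (t : R) : (0 < n)%N -> (forall u, unit_sphere u -> t <= breadth K u) ->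
  t <= width K.
Proof.
move=> n0 Kt; have [u u1] := unit_sphere_neq0 n0.
by apply: lb_le_inf => [|_ [v v1 <-]]; [exists (breadth K u); exists u|exact: Kt].
Qed.

Lemma width_attained K : (0 < n)%N -> compact K -> K !=set0 ->
  minwidth_directions K !=set0.
Proof.
move=> n0 cK K0.
have [u /set_mem u1 umin] := compact_EVT_min (unit_sphere_neq0 n0)
  (compact_sub_sphere (@closed_unit_sphere R n) (@subset_refl _ _))
  (continuous_subspaceT (breadth_continuous cK K0)).
exists u; split=> //; apply/eqP; rewrite eq_le; apply/andP; split.
  by apply: le_width => // v v1; apply: umin; exact/mem_set.
by apply: width_le => // v; exact: breadth_ge0.
Qed.

Lemma closed_minwidth_directions K : compact K -> K !=set0 -> closed (minwidth_directions K).
Proof.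
move=> cK K0.
rewrite (_ : minwidth_directions K =
  @unit_sphere R n `&` breadth K @^-1` [set x | x = width K]) //.
apply: closedI; first exact: closed_unit_sphere.
exact: (continuous_closedP _).1 (breadth_continuous cK K0) _ (@closed_eq _ (width K)).
Qed.

(** Homogeneity carries the bound from the unit sphere to all [v]; squares keep the root in the norm
    out of the statement. *)
Lemma width_sqr_le K v : compact K -> K !=set0 ->
  0 <= width K -> width K ^+ 2 * dot v v <= breadth K v ^+ 2.
Proof.
move=> cK K0 w0; have [->|v0] := eqVneq v 0; first by rewrite dot0l mulr0 sqr_ge0.
have := width_le (fun v => breadth_ge0 v cK K0) (unit_sphere_normalize v0).
have s0 : 0 < Num.sqrt (dot v v) by rewrite sqrtr_gt0 dot_gt0.
rewrite breadthZ ?invr_ge0 ?sqrtr_ge0 // ler_pdivlMl // => h.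
rewrite -[dot v v]sqr_sqrtr ?dot_ge0 // -exprMn mulrC ler_sqr ?nnegrE //.
  by rewrite mulr_ge0 // sqrtr_ge0.
exact: breadth_ge0.
Qed.

End Breadth.

(** * Bodies containing a cube, and isominwidth position without volumes *)

Section Bodies.
Variables (R : realType) (n : nat).
Implicit Types (K L W : set 'cV[R]_n) (u v x y c : 'cV[R]_n) (A M : 'M[R]_n).
Hypothesis n_gt0 : (0 < n)%N.

(** Nonempty interior in the form used by [volume_gt0] and [width_gt0]; it passes to [K - K] by
    subtracting the centre. *)
Definition contains_cube L := exists c (r : R),
  0 < r /\ forall x, (forall i, `|x i 0 - c i 0| <= r) -> L x.

Lemma convex_body_segment K x y (t : R) : convex_body K ->
  K x -> K y -> 0 <= t <= 1 -> K (x + t *: (y - x)).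
Proof.
move=> [_ cvK _] Kx Ky /andP[t0 t1].
have /set_mem := cvK y x (Itv01 t0 t1) (mem_set Ky) (mem_set Kx).
congr (K _); rewrite /conv /= /unstable.onem scalerBr scalerBl scale1r.
by rewrite addrC -addrA (addrC (- _)).
Qed.

Lemma convex_body_cube K : convex_body K -> contains_cube K.
Proof.
case=> _ _ [c /nbhs_ballP[r /= r0 rK]]; exists c, (r / 2).
split=> [|x xc]; first by rewrite divr_gt0.
apply: rK; split=> // i j; rewrite ord1 /ball /= distrC.
by apply: le_lt_trans (xc i) _; rewrite ltr_pdivrMr // ltr_pMr // ltr1n.
Qed.

Lemma contains_cube_neq0 L : contains_cube L -> L !=set0.
Proof. by move=> [c [r [r0 rL]]]; exists c; apply: rL => i; rewrite subrr normr0 ltW. Qed.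

Lemma contains_cube_difference_body K : contains_cube K -> contains_cube (difference_body K).
Proof.
move=> [c [r [r0 rK]]]; exists 0, r; split=> // x xr.
exists (c + x); last first.
  by exists c; [apply: rK => i; rewrite subrr normr0 ltW|rewrite addrC addKr].
by apply: rK => i; have := xr i; rewrite !mxE subr0 addrAC subrr add0r.
Qed.

Lemma volume_contains_cube_gt0 L : contains_cube L -> (0 < volume L)%E.
Proof.
move=> [c [r [r0 rL]]]; apply: (@volume_gt0 _ _ (c - const_mx r) (2 * r)).
  by rewrite mulr_gt0.
move=> x /= xc; apply: rL => i; have := xc i; rewrite !mxE ler_norml; lra.
Qed.

Lemma volume_compact_lty L : compact L -> (volume L < +oo)%E.
Proof. by move=> /compact_entry_bound[M LM]; exact: (volume_lt_pinfty n_gt0 (M := M)). Qed.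

Lemma width_gt0 K : compact K -> contains_cube K -> 0 < width K.
Proof.
move=> cK [c [r [r0 rK]]]; apply: (@lt_le_trans _ _ (2 * r)); first by rewrite mulr_gt0.
apply: le_width => // u u1; have /unit_sphereE u1' := u1.
have u_le1 i : `|u i 0| <= 1.
  by apply: norm_entry_le1; rewrite u1'.
(* The entries of [u] are at most 1 in absolute value, so both [c + r u] and [c - r u] lie in the
   cube; their distance [2 r] bounds the breadth from below. *)
have Kp : K (c + r *: u).
  apply: rK => i; rewrite !mxE addrAC subrr add0r normrM gtr0_norm //.
  by rewrite ler_piMr // ltW.
have Km : K (c - r *: u).
  apply: rK => i; rewrite !mxE addrAC subrr add0r normrN normrM gtr0_norm //.
  by rewrite ler_piMr // ltW.
have := dot_le_support u cK Kp; have := dot_le_support (- u) cK Km.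
rewrite /breadth !(dotDl, dotNl, dotZl, dotNr) u1'; lra.
Qed.

Lemma compact_linear_image A K : compact K -> compact (linear_image A K).
Proof.
apply: continuous_compact; apply: continuous_subspaceT.
by apply: mulmx_continuous => x; [exact: cst_continuous|exact: cvg_id].
Qed.

Lemma width_linear_image_gt0 A K : A \in unitmx -> compact K -> contains_cube K ->
  0 < width (linear_image A K).
Proof.
move=> Au cK cubeK; have K0 := contains_cube_neq0 cubeK.
have w0 := width_gt0 cK cubeK.
have cAK := @compact_linear_image A K cK.
have AK0 : linear_image A K !=set0 by case: K0 => x Kx; exists (A *m x), x.
have [u [u1 <-]] := width_attained n_gt0 cAK AK0.
rewrite -/(breadth _ u) breadth_linear_image.
have v0 : A^T *m u != 0.
  apply/eqP => Au0; have /unit_sphereE := u1.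
  rewrite -(mulKmx (_ : A^T \in unitmx) u) ?unitmx_tr // Au0 mulmx0 dot0l.
  by move/eqP; rewrite eq_sym oner_eq0.
rewrite lt_neqAle breadth_ge0 // andbT eq_sym -sqrf_eq0 gt_eqF //.
apply: lt_le_trans (width_sqr_le _ cK K0 (ltW w0)).
by rewrite mulr_gt0 ?exprn_gt0 // dot_gt0.
Qed.

Definition width_minimal K := forall A, A \in unitmx ->
  width (linear_image A K) ^+ n <= `|\det A| * width K ^+ n.

Lemma isominwidth_positionE K : compact K -> contains_cube K ->
  isominwidth_position K <-> width_minimal K.
Proof.
move=> cK cubeK; have w0 := width_gt0 cK cubeK.
have vfin : volume K \is a fin_num.
  by rewrite ge0_fin_numE ?volume_ge0 // volume_compact_lty.
have v0 := volume_contains_cube_gt0 cubeK.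
have step A : A \in unitmx -> ((iwq K <= iwq (linear_image A K))%E <->
    width (linear_image A K) ^+ n <= `|\det A| * width K ^+ n).
  move=> Au; have wA0 := width_linear_image_gt0 Au cK cubeK.
  rewrite /iwq volume_linear_image // -(fineK vfin) -!EFinM lee_fin.
  have r0 : 0 < fine (volume K) by apply: fine_gt0; rewrite v0 volume_compact_lty.
  rewrite ler_pdivrMr ?exprn_gt0 // mulrAC ler_pdivlMr ?exprn_gt0 //.
  by rewrite [X in _ <= X * _]mulrC -mulrA ler_pM2l.
by split=> h A Au; apply/step => //; exact: h.
Qed.

Lemma width_difference_body K : compact K -> K !=set0 ->
  width (difference_body K) = 2 * width K.
Proof.
move=> cK K0; apply/eqP; rewrite eq_le; apply/andP; split.
  have [u [u1 <-]] := width_attained n_gt0 cK K0.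
  rewrite -/(breadth K u) -breadth_difference_body //; apply: width_le => // v.
  by rewrite breadth_difference_body // mulr_ge0 // breadth_ge0.
apply: le_width => // u u1; rewrite breadth_difference_body // ler_pM2l //.
by apply: width_le => // v; exact: breadth_ge0.
Qed.

Lemma linear_image_difference_body A K :
  linear_image A (difference_body K) = difference_body (linear_image A K).
Proof.
rewrite predeqE => z; split.
  move=> [_ [x Kx [y Ky <-]] <-]; exists (A *m x); first by exists x.
  by exists (A *m y); [exists y|rewrite mulmxBr].
move=> [_ [x Kx <-] [_ [y Ky <-] <-]]; exists (x - y); last by rewrite mulmxBr.
by exists x => //; exists y.
Qed.

Lemma width_minimal_difference_body K : compact K -> K !=set0 ->
  width_minimal (difference_body K) <-> width_minimal K.
Proof.
move=> cK K0.
have wD A : width (linear_image A (difference_body K)) = 2 * width (linear_image A K).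
  rewrite linear_image_difference_body width_difference_body //.
    exact: compact_linear_image.
  by case: K0 => x Kx; exists (A *m x), x.
by split=> h A Au; have := h A Au; rewrite wD width_difference_body // !exprMn mulrCA
  ler_pM2l // exprn_gt0.
Qed.

End Bodies.

(** * Determinant bound from a decomposition, separation, ellipsoids *)

Section Characterization.
Variables (R : realType) (n : nat).
Implicit Types (K L W : set 'cV[R]_n) (u v x y c : 'cV[R]_n) (A M H : 'M[R]_n).
Hypothesis n_gt0 : (0 < n)%N.

(** Taking traces in the decomposition gives total weight [n], so the weighted bounds turn into a
    bound on [tr (M M^T)], to which [det_sqr_le] applies. In one use [a], [b] are the widths of [AK]
    and [K], in the other both are 1. *)
Lemma rank_one_det_bound m (l : 'I_m -> R) (u : 'I_m -> 'cV[R]_n) M (a b : R) :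
  (forall i, 0 <= l i) -> (forall i, unit_sphere (u i)) ->
  1%:M = \sum_i l i *: (u i *m (u i)^T) -> 0 <= a -> 0 <= b ->
  (forall i, a ^+ 2 * dot (M *m u i) (M *m u i) <= b ^+ 2) ->
  a ^+ n * `|\det M| <= b ^+ n.
Proof.
move=> l0 u1 uE a0 b0 Mb; have nR : 0 < n%:R :> R by rewrite ltr0n.
have suml : \sum_i l i = n%:R.
  rewrite -(mxtrace1 R n) {1}uE -[X in \tr X]mul1mx trace_rank_one_sum.
  apply: eq_bigr => i _; rewrite /quad mulmx1 -/(dot _ _).
  by have /unit_sphereE -> := u1 i; rewrite mulr1.
have trM : \tr (M *m M^T) = \sum_i l i * dot (M *m u i) (M *m u i).
  rewrite mxtrace_mulC -[X in \tr X]mulmx1 uE trace_rank_one_sum.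
  by apply: eq_bigr => i _; rewrite /quad /dot trmx_mul !mulmxA.
have trMb : a ^+ 2 * \tr (M *m M^T) <= n%:R * b ^+ 2.
  rewrite trM mulr_sumr -suml mulr_suml; apply: ler_sum => i _.
  by rewrite mulrCA ler_wpM2l.
have tr0 : 0 <= \tr (M *m M^T).
  by rewrite trM; apply: sumr_ge0 => i _; rewrite mulr_ge0 // dot_ge0.
rewrite -ler_sqr ?nnegrE ?mulr_ge0 ?exprn_ge0 // exprMn real_normK ?num_real //.
apply: le_trans (_ : (a ^+ n) ^+ 2 * (\tr (M *m M^T) / n%:R) ^+ n <= _).
  by rewrite ler_wpM2l ?sqr_ge0 // det_sqr_le.
rewrite -!exprM mulnC !exprM -exprMn lerXn2r ?nnegrE ?mulr_ge0 ?sqr_ge0 ?divr_ge0 //.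
by rewrite mulrA ler_pdivrMr // (mulrC (b ^+ 2)).
Qed.

Definition john_decomposition W := exists (m : nat) (l : 'I_m -> R) (u : 'I_m -> 'cV[R]_n),
  [/\ (n <= m <= 'C(n.+1, 2))%N, forall i, 0 <= l i, forall i, W (u i)
    & 1%:M = \sum_(i < m) l i *: (u i *m (u i)^T)].

Lemma john_decomposition_of_sum W :
  rank_one_sum W 'C(n.+1, 2) 1%:M -> john_decomposition W.
Proof.
move=> [l [u [l0 Wu uE]]]; exists 'C(n.+1, 2), l, u; split=> //.
(* The largest admissible length is taken; it is at least [n] because [C(n+1, 2) = C(n, 2) + n]. *)
by rewrite leqnn andbT binS bin1 leq_addl.
Qed.

Lemma width_minimal_of_decomposition K : compact K -> contains_cube K ->
  john_decomposition (minwidth_directions K) -> width_minimal K.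
Proof.
move=> cK cubeK [m [l [u [_ l0 Wu uE]]]] A Au; have K0 := contains_cube_neq0 cubeK.
have cAK := @compact_linear_image _ _ A K cK.
have AK0 : linear_image A K !=set0 by case: K0 => x Kx; exists (A *m x), x.
have dA : 0 < `|\det A| by rewrite normr_gt0 -unitfE -unitmxE.
rewrite -ler_pdivrMl // -normfV -det_inv mulrC -det_tr.
apply: (rank_one_det_bound l0 _ uE) => [i|||i].
- by case: (Wu i).
- exact/ltW/width_linear_image_gt0.
- exact/ltW/width_gt0.
- have w0 := ltW (width_linear_image_gt0 n_gt0 Au cK cubeK).
  (* The breadth of [AK] at [A^-T u] is the breadth of [K] at [u], which is [width K] for a minwidth
     direction. *)
  apply: le_trans (width_sqr_le _ cAK AK0 w0) _.
  rewrite breadth_linear_image mulmxA -trmx_mul mulVmx // trmx1 mul1mx.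
  by case: (Wu i) => _ <-.
Qed.

(** Separation: if [p] is outside [L] and [x] is its nearest point, the normalised direction [p - x]
    violates the bound. *)
Lemma mem_of_dot_le_support L (p : 'cV[R]_n) : compact L -> L !=set0 ->
  (forall x y t, L x -> L y -> 0 <= t <= 1 -> L (x + t *: (y - x))) ->
  (forall u, unit_sphere u -> dot p u <= Defs.support L u) -> L p.
Proof.
move=> cL L0 Lconv Lp; have [x [Lx xnear]] := nearest_point p cL L0 Lconv.
have [xp|xp] := eqVneq (p - x) 0; first by rewrite -(subrK x p) xp add0r.
have near y : L y -> dot y (p - x) <= dot x (p - x).
  move=> Ly; rewrite -subr_le0 -dotBl dotC.
  by have := xnear y Ly; rewrite [_ *m _]mx11_scalar mxtrace_scalar.
have s0 : 0 < Num.sqrt (dot (p - x) (p - x)) by rewrite sqrtr_gt0 dot_gt0.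
have := Lp _ (unit_sphere_normalize xp).
rewrite dotZr supportZ ?invr_ge0 ?sqrtr_ge0 // ler_pM2l ?invr_gt0 //.
have [y Ly [<- _]] := support_attained (p - x) cL L0.
move=> /le_trans/(_ (near y Ly)); rewrite -subr_le0 -dotBl => le0.
by have := dot_gt0 xp; rewrite ltNge le0.
Qed.

(** The maximiser of [dot x v] on the ball, together with its antipode: the pair is what removes the
    centre of an ellipsoid later. *)
Lemma unit_ball_normalize v : v != 0 -> exists x,
  [/\ unit_ball x, unit_ball (- x) & dot x v = Num.sqrt (dot v v)].
Proof.
move=> v0; have /unit_sphereE x1 := unit_sphere_normalize v0.
exists ((Num.sqrt (dot v v))^-1 *: v); split; try apply/unit_ballE.
- by rewrite x1.
- by rewrite dotNl dotNr opprK x1.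
- rewrite dotZl -[X in _ * X]sqr_sqrtr ?dot_ge0 // expr2 mulrA mulVf ?mul1r //.
  by rewrite gt_eqF // sqrtr_gt0 dot_gt0.
Qed.

Lemma dot_sqr_le_ball x u : unit_ball x -> dot x u ^+ 2 <= dot u u.
Proof.
move=> /unit_ballE x1; apply: le_trans (cauchy_schwarz _ _) _.
by rewrite ler_piMl // dot_ge0.
Qed.

Lemma support_unit_ball u : unit_sphere u -> Defs.support (@unit_ball R n) u = 1.
Proof.
move=> /unit_sphereE u1; apply: support_eq.
  by exists u => //; apply/unit_ballE; rewrite u1.
move=> x /(dot_sqr_le_ball u); rewrite u1 -[X in _ <= X](expr1n _ 2) => h.
apply: le_trans (ler_norm _) _.
by rewrite -ler_sqr ?nnegrE // real_normK ?num_real.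
Qed.

Lemma unit_ball_cube : contains_cube (@unit_ball R n).
Proof.
have nR : 0 < n%:R :> R by rewrite ltr0n.
exists 0, n%:R^-1; split=> [|x xn]; first by rewrite invr_gt0.
apply/unit_ballE; rewrite dotE.
apply: le_trans (_ : \sum_(i < n) n%:R^-1 <= _).
  apply: ler_sum => i _; have := xn i; rewrite mxE subr0 => xi.
  rewrite -expr2 -real_normK ?num_real // expr2 -[leRHS]mul1r.
  apply: ler_pM => //; apply: le_trans xi _.
  by rewrite invf_le1 // ler1n.
by rewrite sumr_const card_ord -[leLHS]mulr_natl mulfV // gt_eqF.
Qed.

Lemma volume_unit_ball_gt0 : (0 < volume (@unit_ball R n))%E.
Proof. exact/volume_contains_cube_gt0/unit_ball_cube. Qed.

Lemma volume_unit_ball_fin : volume (@unit_ball R n) \is a fin_num.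
Proof.
rewrite ge0_fin_numE ?volume_ge0 //; apply: (volume_lt_pinfty n_gt0 (M := 1)).
by move=> x /unit_ballE x1 i; exact: norm_entry_le1.
Qed.

Lemma volume_ellipsoid_le A c : A \in unitmx -> `|\det A| <= 1 ->
  (volume [set (A *m x + c)%R | x in @unit_ball R n] <= volume (@unit_ball R n))%E.
Proof.
move=> Au d1.
apply: le_trans (_ : volume (linear_image A (@unit_ball R n)) <= _)%E.
  apply: le_trans (volume_translate_le n_gt0 _ c); apply: le_volume.
  by move=> _ [x Bx <-]; exists (A *m x) => //; exists x.
rewrite volume_linear_image // -[leRHS]mul1e; apply: lee_wpmul2r.
  exact: volume_ge0.
by rewrite lee_fin.
Qed.

(** John position is tested on a centred ellipsoid; the volume of the ball is positive and finite,
    so it cancels. *)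
Lemma det_le1_of_john L A : john_position L -> A \in unitmx ->
  linear_image A (@unit_ball R n) `<=` L -> `|\det A| <= 1.
Proof.
move=> [_ maxL] Au AL.
have Eimg : [set A *m x + 0 | x in @unit_ball R n] = linear_image A (@unit_ball R n).
  by congr image; apply/funext => x; rewrite addr0.
have := maxL _ (ex_intro _ A (ex_intro _ 0 (conj Au (esym Eimg)))) AL.
rewrite volume_linear_image // -(fineK volume_unit_ball_fin) -EFinM lee_fin.
rewrite ger_pMl // fine_gt0 // volume_unit_ball_gt0 /=.
by rewrite ltey_eq volume_unit_ball_fin.
Qed.

End Characterization.

(** * The implications (i) to (iii), (v) to (iv), (iv) to (v) and (iii) to (v) *)

Section Implications.
Variables (R : realType) (n : nat).
Implicit Types (K L W : set 'cV[R]_n) (u v x y c : 'cV[R]_n) (A M H : 'M[R]_n).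
Hypothesis n_gt0 : (0 < n)%N.

Lemma dot_perturbation H (e : R) u : unit_sphere u ->
  dot ((1%:M + e *: H)^T *m u) ((1%:M + e *: H)^T *m u) =
  1 + 2 * e * quad H u + e ^+ 2 * dot (H^T *m u) (H^T *m u).
Proof.
move=> /unit_sphereE u1; rewrite linearD linearZ /= trmx1 mulmxDl mul1mx -scalemxAl.
have Hu : dot u (H^T *m u) = quad H u.
  by rewrite -(quad_tr H) /quad /dot mulmxA.
by rewrite !(dotDl, dotDr, dotZl, dotZr) u1 (dotC _ u) Hu; ring.
Qed.

(** Compactness of the sphere controls the first and second order terms of [dot_perturbation]
    uniformly. *)
Lemma perturbation_bound H : exists2 C : R, 0 < C &
  forall u, unit_sphere u -> quad H u <= C /\ dot (H^T *m u) (H^T *m u) <= C.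
Proof.
have bounded A : exists M : R, forall u, unit_sphere u -> quad A u <= M.
  have cS := compact_sub_sphere (@closed_unit_sphere R n) (@subset_refl _ _).
  have [v _ vmax] := compact_EVT_max (unit_sphere_neq0 R n_gt0) cS
    (continuous_subspaceT (@quad_continuous R n A)).
  by exists (quad A v) => u u1; apply: vmax; exact/mem_set.
have [M1 hM1] := bounded H; have [M2 hM2] := bounded (H *m H^T).
exists (`|M1| + `|M2| + 1); first by rewrite ltr_wpDl // addr_ge0.
move=> u u1; split.
  by have := hM1 u u1; have := ler_norm M1; have := normr_ge0 M2; lra.
have -> : dot (H^T *m u) (H^T *m u) = quad (H *m H^T) u.
  by rewrite /dot /quad trmx_mul trmxK !mulmxA.
by have := hM2 u u1; have := ler_norm M2; have := normr_ge0 M1; lra.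
Qed.

Lemma mem_dilation (t : R) L x : t != 0 -> dilation t^-1 L x <-> L (t *: x).
Proof.
move=> t0; split=> [[y Ly <-]|Lx]; first by rewrite scalerA divff // scale1r.
by exists (t *: x) => //; rewrite scalerA mulVf // scale1r.
Qed.

(** The support function of the image of the ball at [u] is the length of [A^T u], so the hypothesis
    compares support functions; as [K - K] is compact and convex, this suffices by
    [mem_of_dot_le_support]. *)
Lemma unit_ball_sub_dilation K A : convex_body K ->
  (forall u, unit_sphere u ->
     width K ^+ 2 * dot (A^T *m u) (A^T *m u) <= breadth K u ^+ 2) ->
  linear_image A (@unit_ball R n) `<=` dilation (width K)^-1 (difference_body K).
Proof.
move=> hK hA _ [x Bx <-]; have cK : compact K by case: hK.
have cubeK := convex_body_cube hK; have K0 := contains_cube_neq0 cubeK.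
have w0 := width_gt0 n_gt0 cK cubeK.
apply/mem_dilation; first by rewrite gt_eqF.
apply: mem_of_dot_le_support; [exact: compact_difference_body|exact: difference_body_neq0| |].
  move=> _ _ t [y Ky [z Kz <-]] [y' Ky' [z' Kz' <-]] t01.
  exists (y + t *: (y' - y)); first exact: convex_body_segment.
  exists (z + t *: (z' - z)); first exact: convex_body_segment.
  by apply/matrixP => i j; rewrite !mxE; ring.
move=> u u1; rewrite support_difference_body // dotZl dot_mulmxl.
apply: le_trans (ler_norm _) _.
rewrite -ler_sqr ?nnegrE ?breadth_ge0 // real_normK ?num_real // exprMn.
apply: le_trans (hA u u1); rewrite ler_wpM2l ?sqr_ge0 //.
exact: dot_sqr_le_ball.
Qed.

Lemma john_of_width_minimal K : convex_body K -> width_minimal K ->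
  john_position (dilation (width K)^-1 (difference_body K)).
Proof.
move=> hK minK; have cK : compact K by case: hK.
have cubeK := convex_body_cube hK; have K0 := contains_cube_neq0 cubeK.
have w0 := width_gt0 n_gt0 cK cubeK; have wN0 : width K != 0 by rewrite gt_eqF.
split.
  move=> x Bx; apply: (@unit_ball_sub_dilation K 1%:M) => //; last first.
    by exists x => //; rewrite mul1mx.
  by move=> u u1; rewrite trmx1 mul1mx; exact: width_sqr_le (ltW w0).
move=> _ [A [c [Au ->]]] AK; apply: volume_ellipsoid_le => //.
have breadthA v : width K ^+ 2 * dot (A^T *m v) (A^T *m v) <= breadth K v ^+ 2.
  have [Av0|Av0] := eqVneq (A^T *m v) 0; first by rewrite Av0 dot0l mulr0 sqr_ge0.
  have [x [Bx Bxn]] := unit_ball_normalize Av0.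
  set s := Num.sqrt _ => xs.
  have s0 : 0 <= s by exact: sqrtr_ge0.
  have ss : s ^+ 2 = dot (A^T *m v) (A^T *m v) by rewrite sqr_sqrtr // dot_ge0.
  (* By symmetry of [K - K], both [A x + c] and [A x - c] lie in the scaled body; adding the two
     support bounds eliminates [c]. *)
  have /(mem_dilation _ _ wN0) D1 : dilation (width K)^-1 (difference_body K) (A *m x + c).
    by apply: AK; exists x.
  have /(mem_dilation _ _ wN0)/difference_bodyN D2 :
      dilation (width K)^-1 (difference_body K) (A *m (- x) + c).
    by apply: AK; exists (- x).
  have cD := compact_difference_body cK.
  have := dot_le_support v cD D1; have := dot_le_support v cD D2.
  rewrite support_difference_body // -ss => h1 h2.
  rewrite -exprMn ler_sqr ?nnegrE ?breadth_ge0 //; last by rewrite mulr_ge0 // ltW.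
  by move: h1 h2; rewrite dotNl !dotZl !dotDl !dot_mulmxl dotNl xs; lra.
have dA : 0 < `|\det A| by rewrite normr_gt0 -unitfE -unitmxE.
(* At [v = A^-T u] the bound just proved says that the breadth of [A^-1 K] at [u] is at least
   [width K]; minimality tested on [A^-1] then forces [|det A| <= 1]. *)
have wA : width K <= width (linear_image (invmx A) K).
  apply: le_width => // u /unit_sphereE u1; rewrite breadth_linear_image.
  rewrite -ler_sqr ?nnegrE ?breadth_ge0 ?(ltW w0) //.
  apply: le_trans (breadthA _); rewrite mulmxA -trmx_mul mulVmx // trmx1 mul1mx u1.
  by rewrite mulr1.
have := minK (invmx A); rewrite unitmx_inv => /(_ Au).
rewrite det_inv normfV ler_pdivlMl // => h.
rewrite -(ler_pM2r (exprn_gt0 n w0)) mul1r; apply: le_trans h.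
by rewrite ler_wpM2l // lerXn2r ?nnegrE ?(ltW w0) // (le_trans (ltW w0)).
Qed.

Lemma john_halfspaces_of_decomposition W :
  (forall u, W u -> unit_sphere u) -> (forall u, W u -> W (- u)) -> john_decomposition W ->
  john_position (\bigcap_(u in W) supporting_halfspace (@unit_ball R n) u).
Proof.
move=> W1 WN [m [l [u [_ l0 Wu uE]]]]; split.
  move=> x Bx v /W1 v1; rewrite /supporting_halfspace /= support_unit_ball //.
  apply: le_trans (ler_norm _) _.
  rewrite -ler_sqr ?nnegrE // real_normK ?num_real // expr1n.
  by apply: le_trans (dot_sqr_le_ball _ Bx) _; have /unit_sphereE -> := v1.
move=> _ [A [c [Au ->]]] AW; apply: volume_ellipsoid_le => //.
rewrite -(mul1r `|_|) -(expr1n R n) -det_tr.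
apply: (rank_one_det_bound n_gt0 l0 _ uE) => // [i|i]; first exact: W1.
rewrite expr1n mul1r; set v := u i.
have [Av0|Av0] := eqVneq (A^T *m v) 0; first by rewrite Av0 dot0l.
have v1 : unit_sphere v := W1 _ (Wu i).
have vN1 : unit_sphere (- v) := W1 _ (WN _ (Wu i)).
have [x [Bx Bxn]] := unit_ball_normalize Av0.
set s := Num.sqrt _ => xs.
have s0 : 0 <= s by exact: sqrtr_ge0.
have ss : s ^+ 2 = dot (A^T *m v) (A^T *m v) by rewrite sqr_sqrtr // dot_ge0.
(* The halfspaces of [v] and [- v] give [s + c.v <= 1] and [s - c.v <= 1]; their sum is free of
   [c]. *)
have := AW (A *m x + c) (ex_intro2 _ _ x Bx erefl) v (Wu i).
have := AW (A *m (- x) + c) (ex_intro2 _ _ (- x) Bxn erefl) (- v) (WN _ (Wu i)).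
rewrite /supporting_halfspace /= !support_unit_ball // -ss => h1 h2.
rewrite -[leRHS](expr1n _ 2) ler_sqr ?nnegrE //.
by move: h1 h2; rewrite dotNr !dotDl !dot_mulmxl dotNl xs; lra.
Qed.

Lemma decomposition_of_john_halfspaces W : closed W -> W !=set0 ->
  W `<=` @unit_sphere R n ->
  john_position (\bigcap_(u in W) supporting_halfspace (@unit_ball R n) u) ->
  john_decomposition W.
Proof.
move=> Wcl W0 W1 john; have [/john_decomposition_of_sum //|] := john_dichotomy n_gt0 Wcl W1 W0.
move=> [H [c [c0 Hc trH]]]; exfalso.
have [e0 e0_gt0 detH] := det_perturbation_gt1 trH.
have [C C0 CH] := perturbation_bound H.
(* For [e C <= c] and [u] in [W], the squared length of [(I + e H)^T u] is at most
   [1 - 2 e c + e c], which is below 1. *)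
pose e := Num.min e0 (c / C).
have e_gt0 : 0 < e by rewrite lt_min e0_gt0 divr_gt0.
have eC : e * C <= c by rewrite -ler_pdivlMr // ge_min lexx orbT.
have det1 : 1 < \det (1%:M + e *: H) by apply: detH; rewrite e_gt0 ge_min lexx.
have Au : 1%:M + e *: H \in unitmx by rewrite unitmxE unitfE gt_eqF // (lt_trans ltr01).
have : `|\det (1%:M + e *: H)| <= 1.
  apply: det_le1_of_john john Au _ => // _ [x Bx <-] u Wu.
  have u1 := W1 _ Wu; rewrite /supporting_halfspace /= support_unit_ball // dot_mulmxl.
  apply: le_trans (ler_norm _) _.
  rewrite -ler_sqr ?nnegrE // real_normK ?num_real // expr1n.
  apply: le_trans (dot_sqr_le_ball _ Bx) _; rewrite dot_perturbation //.
  have [_ uC] := CH _ u1; have := Hc _ Wu.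
  have : e ^+ 2 * dot (H^T *m u) (H^T *m u) <= e * c.
    by rewrite expr2 -mulrA ler_pM2l // (le_trans _ eC) // ler_pM2l.
  nra.
by rewrite leNgt (lt_le_trans det1) // ler_norm.
Qed.

Lemma decomposition_of_john_difference_body K : convex_body K ->
  john_position (dilation (width K)^-1 (difference_body K)) ->
  john_decomposition (minwidth_directions K).
Proof.
move=> hK john; have cK : compact K by case: hK.
have cubeK := convex_body_cube hK; have K0 := contains_cube_neq0 cubeK.
have w0 := width_gt0 n_gt0 cK cubeK; have w20 : 0 < width K ^+ 2 by rewrite exprn_gt0.
have W0 := width_attained n_gt0 cK K0.
have W1 : minwidth_directions K `<=` @unit_sphere R n by move=> u [].
have [/john_decomposition_of_sum //|] :=
  john_dichotomy n_gt0 (closed_minwidth_directions cK K0) W1 W0.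
move=> [H [c [c0 Hc trH]]]; exfalso.
have [e0 e0_gt0 detH] := det_perturbation_gt1 trH.
have [C C0 CH] := perturbation_bound H.
have width_le' u : unit_sphere u -> width K <= breadth K u.
  by apply: width_le => v; exact: breadth_ge0.
(* [Z] collects the directions in which [H] need not shrink enough. It is compact and misses the
   minwidth directions, where [quad H u <= - c], so on it the squared breadth exceeds [width K ^+ 2]
   by at least a fixed factor [1 + d]. *)
pose Z := @unit_sphere R n `&` quad H @^-1` [set t | - c / 2 <= t].
have [d d0 Zd] : exists2 d : R, 0 < d &
    forall u, Z u -> width K ^+ 2 * (1 + d) <= breadth K u ^+ 2.
  have [Zne|Ze] := pselect (Z !=set0); last by exists 1 => // u Zu; case: Ze; exists u.
  have cZ : compact Z.
    apply: compact_sub_sphere; last by move=> u [].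
    apply: closedI; first exact: closed_unit_sphere.
    exact: (continuous_closedP _).1 (@quad_continuous R n H) _ (@closed_ge _ (- c / 2)).
  have [v /set_mem [v1 Hv] vmin] := compact_EVT_min Zne cZ
    (continuous_subspaceT (breadth_continuous cK K0)).
  have wv : width K < breadth K v.
    rewrite lt_neqAle width_le' // andbT; apply/negP => /eqP wE.
    have /Hc : minwidth_directions K v by split.
    by move: Hv => /= Hv; lra.
  exists (breadth K v ^+ 2 / width K ^+ 2 - 1).
    by rewrite subr_gt0 ltr_pdivlMr // mul1r ltr_sqr ?nnegrE ?breadth_ge0 ?ltW.
  move=> u Zu; rewrite addrC subrK mulrC divfK ?gt_eqF // ler_sqr ?nnegrE ?breadth_ge0 //.
  by apply: vmin; exact/mem_set.
(* On [Z], [2 e C + e^2 C <= 3 e C <= d] because [e <= 1]; off [Z], [- e c + e^2 C <= 0] because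
   [e C <= c]. *)
pose e := Num.min (Num.min e0 1) (Num.min (c / C) (d / (3 * C))).
have e_gt0 : 0 < e by rewrite !lt_min e0_gt0 ltr01 !divr_gt0 // mulr_gt0.
have e1 : e <= 1 by rewrite /e !ge_min lexx !orbT.
have ee0 : e <= e0 by rewrite /e !ge_min lexx.
have eC : e * C <= c by rewrite -ler_pdivlMr // /e !ge_min lexx !orbT.
have ed : e * (3 * C) <= d by rewrite -ler_pdivlMr ?mulr_gt0 // /e !ge_min lexx !orbT.
have det1 : 1 < \det (1%:M + e *: H) by apply: detH; rewrite e_gt0.
have Au : 1%:M + e *: H \in unitmx by rewrite unitmxE unitfE gt_eqF // (lt_trans ltr01).
have : `|\det (1%:M + e *: H)| <= 1.
  apply: det_le1_of_john john Au _ => //; apply: unit_ball_sub_dilation => // u u1.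
  rewrite dot_perturbation //; have [HuC uC] := CH _ u1.
  have eu : e ^+ 2 * dot (H^T *m u) (H^T *m u) <= e * (e * C).
    by rewrite expr2 -mulrA !ler_pM2l.
  have [Hu|Hu] := leP (- c / 2) (quad H u).
    apply: le_trans (Zd u (conj u1 Hu)); rewrite ler_pM2l // -addrA lerD2l.
    apply: le_trans ed.
    have : e * (e * C) <= e * C by rewrite ler_piMl // mulr_ge0 ?ltW.
    have : e * quad H u <= e * C by rewrite ler_pM2l.
    lra.
  apply: (@le_trans _ _ (width K ^+ 2)).
    rewrite ger_pMr //.
    have : e * (e * C) <= e * c by rewrite ler_pM2l.
    have : e * quad H u <= e * (- c / 2) by rewrite ler_pM2l // ltW.
    lra.
  by rewrite ler_sqr ?nnegrE ?breadth_ge0 ?(ltW w0) // width_le'.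
by rewrite leNgt (lt_le_trans det1) // ler_norm.
Qed.

End Implications.

Theorem theorem5p3 (R : realType) (n : nat) (hn : (0 < n)%N)
    (K : set 'cV[R]_n) (hK : convex_body K) :
  [<-> isominwidth_position K;
       isominwidth_position (difference_body K);
       john_position (dilation (width K)^-1 (difference_body K));
       john_position (\bigcap_(u in minwidth_directions K)
                        supporting_halfspace (@unit_ball R n) u);
       exists (m : nat) (lambda : 'I_m -> R) (u : 'I_m -> 'cV[R]_n),
         [/\ (n <= m <= 'C(n.+1, 2))%N,
             forall i, 0 <= lambda i,
             forall i, minwidth_directions K (u i)
           & 1%:M = \sum_(i < m) lambda i *: (u i *m (u i)^T)]].
Proof.
have cK : compact K by case: hK.
have cubeK := convex_body_cube hK; have K0 := contains_cube_neq0 cubeK.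
have minK := isominwidth_positionE hn cK cubeK.
have minD : isominwidth_position (difference_body K) <-> width_minimal K.
  apply: iff_trans (width_minimal_difference_body hn cK K0).
  apply: isominwidth_positionE => //; first exact: compact_difference_body.
  exact: contains_cube_difference_body.
have W1 u : minwidth_directions K u -> unit_sphere u by case.
tfae.
- by move=> /minK/minD.
- by move=> /minD/(john_of_width_minimal hn hK).
- move=> /(decomposition_of_john_difference_body hn hK).
  apply: john_halfspaces_of_decomposition => // u [u1 uw]; split.
    by apply/unit_sphereE; rewrite dotNl dotNr opprK; apply/unit_sphereE.
  by rewrite -uw -/(breadth K u) -breadthN.
- apply: decomposition_of_john_halfspaces => //.
    exact: closed_minwidth_directions.
  exact: width_attained.
- by move=> /(width_minimal_of_decomposition hn cK cubeK)/minK.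
Qed.
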